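(* Let $n\ge 1$ and let $X_1,\dots,X_n$ be independent, square integrable random variables with values in the lattice $\mathcal L(v_0,D)$, with $\vartheta_{X_j}>0$ for $j=1,\dots,n$, and let $S_n=X_1+\dots+X_n$. Then for any $0<h<1$, any $\vartheta_j$ with $0<\vartheta_j\le \vartheta_{X_j}$ ($j=1,\dots,n$), and all $\kappa\in\mathcal L(v_0n,D)$, $$\mathbb P\{S_n=\kappa\}\le \Big(\frac{1+h}{1-h}\Big)\frac{D}{\sqrt{2\pi\,\mathrm{Var}(S_n)}}\,e^{-\frac{(\kappa-\mathbb E S_n)^2}{2(1+h)\mathrm{Var}(S_n)}}+\frac{C_1}{\sqrt{(1-h)\Theta_n}}\Big(H_n+\frac{1}{(1-h)\Theta_n}\Big)+\rho_n(h),$$ and $$\mathbb P\{S_n=\kappa\}\ge \Big(\frac{1-h}{1+h}\Big)\frac{D}{\sqrt{2\pi\,\mathrm{Var}(S_n)}}\,e^{-\frac{(\kappa-\mathbb E S_n)^2}{2(1-h)\mathrm{Var}(S_n)}}-\frac{C_1}{\sqrt{(1-h)\Theta_n}}\Big(H_n+\frac{1}{(1-h)\Theta_n}+2\rho_n(h)\Big)-\rho_n(h).$$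
   Context: Lattice: $v_0\in\mathbb R$ and $D>0$ are fixed, $v_k=v_0+Dk$ for $k\in\mathbb Z$, and $\mathcal L(v_0,D)=\{v_k:k\in\mathbb Z\}$; likewise $\mathcal L(v_0n,D)=\{v_0n+Dk:k\in\mathbb Z\}$. For a random variable $X$ with $\mathbb P\{X\in\mathcal L(v_0,D)\}=1$, put $\vartheta_X=\sum_{k\in\mathbb Z}\min(\mathbb P\{X=v_k\},\mathbb P\{X=v_{k+1}\})$. Bernoulli part: for each $j$, put $f_j(k)=\mathbb P\{X_j=v_k\}$ and $\tau_k^{(j)}=\frac{\vartheta_j}{\vartheta_{X_j}}\min(f_j(k),f_j(k+1))$ for $k\in\mathbb Z$. Let $(V_1,\varepsilon_1),\dots,(V_n,\varepsilon_n)$ be mutually independent pairs with laws $\mathbb P\{(V_j,\varepsilon_j)=(v_k,1)\}=\tau_k^{(j)}$ and $\mathbb P\{(V_j,\varepsilon_j)=(v_k,0)\}=f_j(k)-\frac{\tau_{k-1}^{(j)}+\tau_k^{(j)}}{2}$, $k\in\mathbb Z$. In particular $\mathbb P\{\varepsilon_j=1\}=1-\mathbb P\{\varepsilon_j=0\}=\vartheta_j$. Put $W_n=\sum_{j=1}^nV_j$, $B_n=\sum_{j=1}^n\varepsilon_j$, $S_n'=W_n+\frac D2B_n$, $\Theta_n=\sum_{j=1}^n\vartheta_j$, and $$H_n=\sup_{x\in\mathbb R}\Big|\mathbb P\Big\{\frac{S_n'-\mathbb E S_n'}{\sqrt{\mathrm{Var}(S_n')}}<x\Big\}-\mathbb P\{g<x\}\Big|,\qquad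 \rho_n(h)=\mathbb P\Big\{\Big|\sum_{j=1}^n\varepsilon_j-\Theta_n\Big|>h\Theta_n\Big\},$$ where $g$ is a standard normal random variable. Constants: $C_0$ is an absolute constant such that for all integers $N\ge1$, $\sup_{z\in\mathbb Z}\big|\mathbb P\{\mathcal B_N=z\}-\sqrt{\tfrac{2}{\pi N}}\,e^{-(2z-N)^2/(2N)}\big|\le C_0N^{-3/2}$, where $\mathcal B_N$ is a sum of $N$ i.i.d. variables taking the values $0$ and $1$ with probability $1/2$ each (such a constant exists). $C_1=\max(4,C_0)$. *)

(* Defs.v *)
From mathcomp Require Import all_boot all_order all_algebra.
From mathcomp Require Import all_classical all_reals all_analysis.

Set Implicit Arguments.
Unset Strict Implicit.
Unset Printing Implicit Defensive.

Import Order.TTheory GRing.Theory Num.Theory.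
Import numFieldNormedType.Exports.

Local Open Scope classical_set_scope.
Local Open Scope ring_scope.

(* Probabilities, expectations and variances are extended reals in the library;
   below they are read as reals through [fine], all of them being finite. *)

Definition lattice_point (R : realType) (v0 D : R) (k : int) : R :=
  v0 + D * k%:~R.

Definition lattice (R : realType) (v0 D : R) : set R :=
  range (lattice_point v0 D).

(* The product rule over every finite subfamily, for families indexed by a
   possibly infinite type. *)
Definition mutually_independent d d' (T : measurableType d)
    (T' : measurableType d') (R : realType) (P : probability T R)
    (I : eqType) (X : I -> T -> T') : Prop :=
  forall (s : seq I) (A : I -> set T'),
    uniq s -> (forall i, measurable (A i)) ->
    P [set w | forall i, i \in s -> A i (X i w)] =
    (\prod_(i <- s) P (X i @^-1` A i))%E.

Section lattice_variable.
Context d (T : measurableType d) (R : realType) (P : probability T R).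
Variables (v0 D : R) (X : {RV P >-> R}).

Definition lattice_pmf (k : int) : R := pmf X (lattice_point v0 D k).

Definition vartheta : R :=
  fine (\esum_(k in [set: int])
    (Num.min (lattice_pmf k) (lattice_pmf (k + 1)))%:E).

Definition tau (th : R) (k : int) : R :=
  th / vartheta * Num.min (lattice_pmf k) (lattice_pmf (k + 1)).

End lattice_variable.

Definition has_bernoulli_part_law d1 d2 (T1 : measurableType d1)
    (T2 : measurableType d2) (R : realType)
    (P : probability T1 R) (Q : probability T2 R) (v0 D th : R)
    (X : {RV P >-> R}) (V eps : {RV Q >-> R}) : Prop :=
  forall k : int,
    Q [set w | V w = lattice_point v0 D k /\ eps w = 1] =
      (tau v0 D X th k)%:E /\
    Q [set w | V w = lattice_point v0 D k /\ eps w = 0] =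
      (lattice_pmf v0 D X k
       - (tau v0 D X th (k - 1) + tau v0 D X th k) / 2)%:E.

Definition esp d (T : measurableType d) (R : realType) (P : probability T R)
  (S : T -> R) : R := fine 'E_P[S].

Definition var d (T : measurableType d) (R : realType) (P : probability T R)
  (S : T -> R) : R := fine 'V_P[S].

(* The Kolmogorov distance between the standardization of [S] and N(0, 1). *)
Definition normal_distance d (T : measurableType d) (R : realType)
    (P : probability T R) (S : T -> R) : R :=
  sup (range (fun x : R =>
    `| fine (P [set w | (S w - esp P S) / Num.sqrt (var P S) < x])
       - fine (normal_prob 0 1 `]-oo, x[) |)).

Definition fair_bits d (T : measurableType d) (R : realType)
    (P : probability T R) (b : nat -> {RV P >-> R}) : Prop :=
  mutually_independent P (fun i w => b i w) /\
  forall i, P [set w | b i w = 0] = (2^-1)%:E /\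
            P [set w | b i w = 1] = (2^-1)%:E.

(* [C0] bounds the error in the local limit theorem for sums of fair bits,
   uniformly in the number N of terms and the value z. *)
Definition local_limit_constant d (T : measurableType d) (R : realType)
    (P : probability T R) (b : nat -> {RV P >-> R}) (C0 : R) : Prop :=
  forall N : nat, (0 < N)%N -> forall z : int,
    `| fine (P [set w | \sum_(i < N) b i w = z%:~R])
       - Num.sqrt (2 / (pi * N%:R))
         * expR (- ((2 * z%:~R - N%:R) ^+ 2 / (2 * N%:R))) |
    <= C0 * N%:R `^ (- (3 / 2)).

(* Main.v *)
Require Import Defs.
From HB Require Import structures.
From mathcomp Require Import all_boot all_order all_algebra.
From mathcomp Require Import all_classical all_reals all_analysis.
From mathcomp Require Import measurable_realfun ring lra.

Set Implicit Arguments.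
Unset Strict Implicit.
Unset Printing Implicit Defensive.

Import Order.TTheory GRing.Theory Num.Theory.
Import numFieldNormedType.Exports.

Local Open Scope classical_set_scope.
Local Open Scope ring_scope.


(** Let L_1, ..., L_n be fair bits independent of the pairs (V_j, eps_j).  The
    law of (V_j, eps_j) is made so that V_j + D eps_j L_j has the law of X_j:
    half of each mass [tau k] stays at v_k and half moves to v_(k+1).  Hence S
    has the law of W + D (eps_1 L_1 + ... + eps_n L_n), and conditionally on
    (V, eps) it is W plus D times a sum of B fair bits.  Therefore P(S = kappa)
    is the expectation of the probability that B fair bits add up to
    (kappa - W) / D.  The local limit theorem for fair bits replaces this
    probability by
        sqrt (2 / (pi B)) exp (- 2 (kappa - S')^2 / (D^2 B)),
    up to C0 B^(-3/2).  On the event |B - Theta| <= h Theta one can bound B by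
    (1 - h) Theta and (1 + h) Theta; the complement has probability rho.

    What is left is the expectation of a Gaussian bump
    exp (- (kappa - S')^2 / (2 a^2)) with a^2 = D^2 (1 +- h) Theta / 4.  Its
    superlevel sets are intervals, so by the layer-cake formula replacing S' by
    a normal variable with the same mean and variance costs at most 2 H
    ([integral_bump_normal_distance]), and for that normal variable the
    expectation is explicit, with variance a^2 + Var S'.  Finally E S = E S' and
    Var S = Var S' + D^2 Theta / 4, because eps_j (L_j - 1/2) is centered given
    (V, eps) and has variance th_j / 4 ([smoothed_moments]).  So a^2 + Var S'
    differs from Var S by h D^2 Theta / 4 <= h Var S.  The ratio of the peak
    height to the target is then sqrt ((1 +- h) / (1 -+ h)), which lies on the
    right side of (1 +- h) / (1 -+ h).

    The bits L_j are never built as random variables: an expectation over them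
    is an average over the 2^n words [l].  The law identity for S is proved
    cell by cell on the countable grid of values of (X_1, ..., X_n)
    ([cell_mixture]) and then summed ([integral_mixture]). *)

(** * Countable partitions and mixtures of measures *)

Section countable_union.
Local Open Scope ereal_scope.
Context d (T : measurableType d) (R : realType) (C : countType).

Lemma bigcup_pickle_inv (E : C -> set T) :
  \bigcup_c E c = \bigcup_i oapp E set0 (pickle_inv i).
Proof.
apply/seteqP; split=> [x [c _ Ecx]|x [i _]].
  by exists (pickle c) => //; rewrite pickleK_inv.
by case: (pickle_inv i) => //= c Ecx; exists c.
Qed.

Lemma measurable_oapp (E : C -> set T) o :
  (forall c, measurable (E c)) -> measurable (oapp E set0 o).
Proof. by move=> mE; case: o => /=. Qed.

Lemma countable_bigcup_measurable (E : C -> set T) :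
  (forall c, measurable (E c)) -> measurable (\bigcup_c E c).
Proof.
by move=> mE; rewrite bigcup_pickle_inv; apply: bigcupT_measurable => i;
  exact: measurable_oapp.
Qed.

(** [pickle_inv] rather than [unpickle]: the latter may take the same value at
    several codes, and then the enumerated sets would not be disjoint. *)
Lemma trivIset_pickle_inv (E : C -> set T) : trivIset setT E ->
  trivIset setT (fun i => oapp E set0 (pickle_inv i)).
Proof.
move=> tE i j _ _.
case Ei: (pickle_inv i) => [c|] /=; last by move=> [x []].
case Ej: (pickle_inv j) => [c'|] /=; last by move=> [x []].
move=> /(tE c c' I I) ecc'.
have := @pickle_invK C i; have := @pickle_invK C j.
by rewrite Ei Ej /= ecc' => -> ->.
Qed.

Lemma integral_countable_partition (P : {measure set T -> \bar R})
    (E : C -> set T) (f : T -> R) (g : C -> R) :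
  (forall c, measurable (E c)) -> trivIset setT E ->
  measurable_fun setT f -> (forall x, 0 <= f x)%R ->
  (forall c x, E c x -> f x = g c) ->
  \int[P]_(x in \bigcup_c E c) (f x)%:E =
    \sum_(i <oo) (oapp g 0%R (pickle_inv i))%:E * P (oapp E set0 (pickle_inv i)).
Proof.
move=> mE tE mf f0 fg; rewrite bigcup_pickle_inv ge0_integral_bigcup//.
- apply: eq_eseriesr => i _; rewrite -integral_cst//; last exact: measurable_oapp.
  apply: eq_integral => x /set_mem; case: (pickle_inv i) => [c|]//= Ecx.
  by rewrite (fg c).
- by move=> i; exact: measurable_oapp.
- by apply/measurable_EFinP; exact: measurable_funTS.
- by move=> x _; rewrite lee_fin.
- exact: trivIset_pickle_inv.
Qed.

Lemma esum_pickle_inv (h : C -> \bar R) : (forall c, 0 <= h c) ->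
  \esum_(c in [set: C]) h c = \sum_(i <oo) oapp h 0 (pickle_inv i).
Proof.
move=> h0; pose J i := [set c | @pickle_inv C i = Some c].
have -> : [set: C] = \bigcup_i J i.
  by apply/seteqP; split=> // c _; exists (pickle c) => //=; exact: pickleK_inv.
rewrite nneseries_sum_bigcup//.
  apply: eq_eseriesr => i _; rewrite /J.
  case: (pickle_inv i) => [c|]/=.
    rewrite (_ : [set _ | _] = [set c]) ?esum_set1//.
    by apply/seteqP; split=> c' /= => [[]|->].
  rewrite (_ : [set _ | _] = set0) ?esum_set0//.
  by apply/seteqP; split.
move=> i j _ _ [c []]; rewrite /J/= => ic jc.
by have := @pickle_invK C i; have := @pickle_invK C j; rewrite ic jc /= => -> ->.
Qed.

Lemma ge0_esumZl (h : C -> \bar R) (a : R) : (0 <= a)%R ->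
  (forall c, 0 <= h c) ->
  \esum_(c in [set: C]) (a%:E * h c) = a%:E * \esum_(c in [set: C]) h c.
Proof.
move=> a0 h0; rewrite !esum_pickle_inv//; last by move=> c; rewrite mule_ge0.
rewrite -nneseriesZl; last by move=> i _; case: (pickle_inv i) => /=.
by apply: eq_eseriesr => i _; case: (pickle_inv i) => //=; rewrite mule0.
Qed.

Lemma measure_countable_bigcup (P : {measure set T -> \bar R}) (E : C -> set T) :
  (forall c, measurable (E c)) -> trivIset setT E ->
  P (\bigcup_c E c) = \esum_(c in [set: C]) P (E c).
Proof.
move=> mE tE; rewrite bigcup_pickle_inv measure_bigcup//=; last 2 first.
  by move=> i _; exact: measurable_oapp.
  exact: trivIset_pickle_inv.
rewrite esum_pickle_inv// (eq_eseriesl (Q := xpredT)); last first.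
  by move=> i; rewrite in_setT.
by apply: eq_eseriesr => i _; case: (pickle_inv i) => //=; rewrite measure0.
Qed.

End countable_union.

Lemma measurable_forall_fin d (T : measurableType d) (I : finType)
    (B : I -> set T) : (forall i, measurable (B i)) ->
  measurable [set w | forall i, B i w].
Proof.
move=> mB; have -> : [set w | forall i, B i w] = \bigcap_(i in setT) B i.
  by apply/seteqP; split=> w H i //; exact: H.
exact: fin_bigcap_measurable.
Qed.

(** A measure P on the cells E c that is an average, over the labels l, of the
    masses of the cells F l c under Q.  The two families may live on different
    spaces; the cells are what identifies their points. *)
Section transfer.
Local Open Scope ereal_scope.
Context d d' (T : measurableType d) (T' : measurableType d') (R : realType).
Variables (P : probability T R) (Q : probability T' R).
Variables (C : countType) (L : finType) (E : C -> set T) (F : L -> C -> set T').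
Variable a : R.
Hypothesis (a_ge0 : (0 <= a)%R) (aL : (a * #|L|%:R = 1)%R).
Hypothesis mE : forall c, measurable (E c).
Hypothesis mF : forall l c, measurable (F l c).
Hypothesis tE : trivIset setT E.
Hypothesis tF : forall l, trivIset setT (F l).
Hypothesis PE : forall c, P (E c) = \sum_(l : L) a%:E * Q (F l c).

Lemma integral_mixture (f : T -> R) (g : C -> R) (f' : L -> T' -> R) :
  measurable_fun setT f -> (forall l, measurable_fun setT (f' l)) ->
  (forall x, 0 <= f x)%R -> (forall l x, 0 <= f' l x)%R ->
  (forall c, 0 <= g c)%R ->
  (forall c x, E c x -> f x = g c) ->
  (forall l c x, F l c x -> f' l x = g c) ->
  \int[P]_(x in \bigcup_c E c) (f x)%:E =
    \sum_(l : L) a%:E * \int[Q]_(x in \bigcup_c F l c) (f' l x)%:E.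
Proof.
move=> mf mf' f0 f'0 g0 fg f'g.
rewrite (integral_countable_partition P (g := g))//.
under [RHS]eq_bigr => l _.
  rewrite (integral_countable_partition Q (g := g))//; last exact: f'g.
  rewrite -nneseriesZl; last first.
    move=> i _; apply: mule_ge0 => //.
    by rewrite lee_fin; case: (pickle_inv i) => /=.
  over.
rewrite -nneseries_sum/=; last first.
  move=> l i _; apply: mule_ge0; first by rewrite lee_fin.
  apply: mule_ge0 => //.
  by rewrite lee_fin; case: (pickle_inv i) => /=.
apply: eq_eseriesr => i _; case: (pickle_inv i) => [c|]/=; last first.
  by rewrite mul0e big1// => l _; rewrite mul0e mule0.
rewrite PE ge0_sume_distrr; last by move=> l _; rewrite mule_ge0.
by apply: eq_bigr => l _; rewrite muleCA.
Qed.

Lemma mixture_total_mass :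
  P (\bigcup_c E c) = \sum_(l : L) a%:E * Q (\bigcup_c F l c).
Proof.
have mass d1 (T1 : measurableType d1) (M : probability T1 R) (D : C -> set T1) :
    (forall c, measurable (D c)) ->
    \int[M]_(x in \bigcup_c D c) (cst 1%R x)%:E = M (\bigcup_c D c).
  move=> /countable_bigcup_measurable mU.
  by rewrite -[RHS]mul1e -(integral_cst M mU).
rewrite -mass// (@integral_mixture (cst 1%R) (cst 1%R) (fun=> cst 1%R))//.
by apply: eq_bigr => l _; rewrite mass.
Qed.

(** An average of numbers at most 1 that equals 1 has all its terms equal to 1.
    So the cells on the Q side carry the whole mass as soon as those on the P
    side do. *)
Lemma mixture_full_mass : P (\bigcup_c E c) = 1 ->
  forall l, Q (\bigcup_c F l c) = 1.
Proof.
rewrite mixture_total_mass => sum1 l.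
pose q l := fine (Q (\bigcup_c F l c)).
have mU l' : measurable (\bigcup_c F l' c) by exact: countable_bigcup_measurable.
have qE l' : Q (\bigcup_c F l' c) = (q l')%:E.
  by rewrite fineK// fin_num_measure.
have q1 l' : (q l' <= 1)%R by rewrite -lee_fin -qE probability_le1.
move: sum1; under eq_bigr do rewrite qE -EFinM.
rewrite sumEFin => -[sum1]; rewrite qE; congr (_%:E).
have a0 : a != 0%R by apply: contra_eq_neq aL => ->; rewrite mul0r eq_sym oner_eq0.
have : (\sum_(l' : L) a * (1 - q l') = 0)%R.
  rewrite -mulr_sumr sumrB mulrBr [X in (_ - X)%R]mulr_sumr sum1 sumr_const.
  by rewrite aL subrr.
move/eqP; rewrite psumr_eq0; last by move=> l' _; rewrite mulr_ge0 ?subr_ge0.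
move/allP => /(_ l); rewrite mem_index_enum => /(_ isT)/implyP/(_ isT).
by rewrite mulf_eq0 (negbTE a0)/= subr_eq0 => /eqP.
Qed.

End transfer.

Section full_measure.
Local Open Scope ereal_scope.
Context d (T : measurableType d) (R : realType) (P : probability T R).

Lemma full_measure_ae (U : set T) : measurable U -> P U = 1 ->
  {ae P, forall x, U x}.
Proof.
move=> mU PU; exists (~` U); split => //; first exact: measurableC.
by rewrite probability_setC// PU subee.
Qed.

Lemma full_measure_integral (U : set T) (f : T -> \bar R) :
  measurable U -> P U = 1 -> measurable_fun setT f ->
  (forall x, 0 <= f x) -> \int[P]_x f x = \int[P]_(x in U) f x.
Proof.
move=> mU PU mf f0.
rewrite (@ge0_negligible_integral _ _ _ P setT (~` U))//.
- by rewrite setTD setCK.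
- exact: measurableC.
- have : P (~` U) = 0 by rewrite probability_setC// PU subee.
  exact.
Qed.

Lemma ae_eq_measure (A B : set T) : measurable A -> measurable B ->
  {ae P, forall x, A x <-> B x} -> P A = P B.
Proof.
move=> mA mB AB.
rewrite -[A]setIT -[B]setIT -!integral_indic//.
apply: ge0_ae_eq_integral => //.
- by apply/measurable_EFinP; exact: measurable_indic.
- by apply/measurable_EFinP; exact: measurable_indic.
apply: filterS AB => x AB _; rewrite !indicE; congr (_%:R%:E).
by congr nat_of_bool; apply/idP/idP => /set_mem/AB/mem_set.
Qed.

End full_measure.

(** * Sums of fair bits *)

Section fair_bits.
Context (R : realType).

Lemma half_pow_bits_card n :
  (2^-1 : R) ^+ n * #|{: {ffun 'I_n -> bool}}|%:R = 1.
Proof.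
by rewrite card_ffun card_bool card_ord natrX -exprMn mulVf ?expr1n// pnatr_eq0.
Qed.

(** The generating polynomial of the masked sum is the product over j of
    (1 + X^(e j)) / 2, and a position with [e j = false] contributes the factor
    1.  Hence the law of the masked sum depends only on the number of positions
    kept. *)
Lemma masked_bits_coef n (e : 'I_n -> bool) (m : nat) :
  \sum_(l : {ffun 'I_n -> bool})
     (2^-1) ^+ n * ((\sum_j e j * l j)%N == m)%:R =
  ((2^-1 *: (1 + 'X)) ^+ (\sum_j e j)%N : {poly R})`_m.
Proof.
rewrite expr_sum.
have -> : \prod_(j < n) (2^-1 *: (1 + 'X)) ^+ e j =
    \prod_(j < n) \sum_(l : bool) 2^-1 *: 'X^(e j * l) :> {poly R}.
  apply: eq_bigr => j _; rewrite big_bool/= muln1 muln0 expr0 -scalerDr.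
  case: (e j); first by rewrite expr1 addrC.
  by rewrite !expr0 -mul_polyC -polyC1 -polyCD -polyCM mulVf ?polyC1// pnatr_eq0.
rewrite bigA_distr_bigA/= coef_sum; apply: eq_bigr => l _.
rewrite scaler_prod prodr_const card_ord -expr_sum coefZ coefXn.
by rewrite eq_sym.
Qed.

Lemma masked_bits_sum n (e : 'I_n -> bool) (z : int) :
  \sum_(l : {ffun 'I_n -> bool})
     (2^-1) ^+ n * ((\sum_j e j * l j)%N%:Z == z)%:R =
  \sum_(l : {ffun 'I_(\sum_j e j)%N -> bool})
     (2^-1) ^+ (\sum_j e j)%N * ((\sum_j l j)%N%:Z == z)%:R :> R.
Proof.
case: z => m; last by rewrite [LHS]big1 ?[RHS]big1// => l _; rewrite mulr0.
rewrite masked_bits_coef; have := masked_bits_coef (fun=> true) m.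
move=> /(_ (\sum_j e j)%N); rewrite sum_nat_const card_ord muln1 => <-.
apply: eq_bigr => l _; congr (_ * (_ == _)%:R).
by apply: eq_bigr => j _; rewrite mul1n.
Qed.

Context d (T : measurableType d) (P : probability T R) (b : nat -> {RV P >-> R}).
Hypothesis fair_b : fair_bits b.

Let bits_event N (c : {ffun 'I_N -> bool}) :=
  [set w | forall i : 'I_N, b i w = (c i)%:R].

Let A N (c : {ffun 'I_N -> bool}) i : set R :=
  if insub i is Some j then [set (c j)%:R] else setT.

Let bits_eventE N (c : {ffun 'I_N -> bool}) :
  bits_event c = [set w | forall i, i \in iota 0 N -> A c i (b i w)].
Proof.
apply/seteqP; split=> w /= H i.
  rewrite mem_iota /= add0n => iN; rewrite /A.
  by case: insubP => [j _ ji|]//=; rewrite -ji; exact: H.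
have := H i; rewrite mem_iota add0n ltn_ord => /(_ isT).
by rewrite /A valK.
Qed.

Let measurable_A N (c : {ffun 'I_N -> bool}) i : measurable (A c i).
Proof. by rewrite /A; case: insubP. Qed.

Let measurable_bits N (c : {ffun 'I_N -> bool}) : measurable (bits_event c).
Proof.
apply: (@measurable_forall_fin _ _ _ (fun i : 'I_N => b i @^-1` [set (c i)%:R])) => i.
exact: measurable_funPTI.
Qed.

Let bits_prob N (c : {ffun 'I_N -> bool}) :
  P (bits_event c) = ((2^-1) ^+ N)%:E.
Proof.
rewrite bits_eventE; have [indep half] := fair_b.
rewrite indep ?iota_uniq//.
have -> : iota 0 N = index_iota 0 N by rewrite /index_iota subn0.
rewrite big_mkord (eq_bigr (fun=> (2^-1)%:E)).
  by rewrite prodEFin prodr_const card_ord.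
move=> i _; rewrite /A valK; have [h0 h1] := half i.
by case: (c i).
Qed.

(** The values of the first N bits cut the space into events of mass 2^-N, so this
    is an instance of [integral_mixture] in which each cell on the second space
    is everything or nothing. *)
Lemma fair_bits_pmf N (z : int) :
  fine (P [set w | \sum_(i < N) b i w = z%:~R]) =
  \sum_(l : {ffun 'I_N -> bool}) (2^-1) ^+ N * ((\sum_j l j)%N%:Z == z)%:R.
Proof.
pose B := [set w | \sum_(i < N) b i w = z%:~R].
pose F (l c : {ffun 'I_N -> bool}) : set T := if c == l then setT else set0.
have mF l c : measurable (F l c) by rewrite /F; case: ifP.
have tE : trivIset setT (@bits_event N).
  move=> c c' _ _ [w []] /= Ec Ec'; apply/ffunP => i.
  by have := Ec i; rewrite Ec' => /eqP; rewrite eqr_nat; case: (c i) (c' i) => [] [].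
have tF l : trivIset setT (F l).
  by move=> c c' _ _ [w []]; rewrite /F; case: eqP => // ->; case: eqP.
have UF l : \bigcup_c F l c = setT.
  by apply/seteqP; split=> // w _; exists l => //; rewrite /F eqxx.
have a0 : 0 <= (2^-1 : R) ^+ N by rewrite exprn_ge0 ?invr_ge0.
have PE c : P (bits_event c) = (\sum_l ((2^-1) ^+ N)%:E * P (F l c))%E.
  rewrite bits_prob (bigD1 c)//= /F eqxx probability_setT mule1 big1 ?adde0//.
  by move=> l /negbTE lc; rewrite eq_sym lc measure0 mule0.
have mB : measurable B.
  have -> : B = (fun w => \sum_(i < N) b i w) @^-1` [set z%:~R] by [].
  rewrite -[X in measurable X]setTI; exact: measurable_sum.
have U1 : P (\bigcup_c @bits_event N c) = 1%E.
  rewrite (mixture_total_mass (Q := P) (F := F) (a := (2^-1) ^+ N))//.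
  under eq_bigr do rewrite UF probability_setT mule1.
  by rewrite sumEFin sumr_const -[X in X%:E]mulr_natr half_pow_bits_card.
have mU : measurable (\bigcup_c @bits_event N c).
  exact: countable_bigcup_measurable.
rewrite -/B; apply: EFin_inj; rewrite fineK ?fin_num_measure//.
have -> : P B = (\int[P]_x (\1_B x)%:E)%E by rewrite integral_indic// setIT.
rewrite (full_measure_integral mU U1)//; last first.
  by apply/measurable_EFinP; exact: measurable_indic.
rewrite (integral_mixture a0 (@measurable_bits N) mF tE tF PE (f := \1_B)
  (g := fun c => ((\sum_j c j)%N%:Z == z)%:R)
  (f' := fun l => cst ((\sum_j l j)%N%:Z == z)%:R))//; last first.
- by move=> l c w; rewrite /F; case: eqP => // ->.
- move=> c w Ec.
  have sE : \sum_(i < N) b i w = (\sum_j c j)%N%:Z%:~R :> R.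
    by rewrite -pmulrn natr_sum; apply: eq_bigr => i _; exact: Ec.
  rewrite indicE; congr (nat_of_bool _)%:R; apply/idP/eqP => [/set_mem|zE].
    by rewrite /B/= sE => /intr_inj.
  by apply/mem_set; rewrite /B/= sE zE.
- rewrite -sumEFin; apply: eq_bigr => l _; rewrite UF EFinM; congr (_ * _)%E.
  by rewrite -[RHS]mule1 -(probability_setT P) -integral_cst.
Qed.

End fair_bits.

Section bits_average.
Context (R : realType) (n : nat).

Let flip (j : 'I_n) (l : {ffun 'I_n -> bool}) : {ffun 'I_n -> bool} :=
  [ffun i => if i == j then ~~ l i else l i].

Let flip_inj j : injective (flip j).
Proof.
apply: (can_inj (g := flip j)) => l; apply/ffunP => i; rewrite !ffunE.
by case: eqP => // _; rewrite negbK.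
Qed.

Let centered (y : 'I_n -> R) (l : {ffun 'I_n -> bool}) (j : 'I_n) : R :=
  ((l j)%:R - 2^-1) * y j.

(** Flipping the bit j is an involution of the words that changes the sign of the
    centered bit and fixes G. *)
Lemma centered_bit_orthogonal (y : 'I_n -> R) j (G : {ffun 'I_n -> bool} -> R) :
  (forall l, G (flip j l) = G l) -> \sum_l centered y l j * G l = 0.
Proof.
move=> Gflip; set s := \sum_l _.
have sN : s = - s.
  rewrite {1}/s (reindex_inj (@flip_inj j)) -sumrN; apply: eq_bigr => l _.
  rewrite Gflip -mulNr; congr (_ * _); rewrite /centered ffunE eqxx -mulNr.
  by congr (_ * _); case: (l j) => /=; lra.
by lra.
Qed.

Lemma bits_average_sqr (x : R) (y : 'I_n -> R) :
  \sum_(l : {ffun 'I_n -> bool})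
    (2^-1) ^+ n * (x + \sum_j (l j)%:R * y j) ^+ 2 =
  (x + (\sum_j y j) / 2) ^+ 2 + (\sum_j y j ^+ 2) / 4.
Proof.
set z := x + _ / 2.
have expand (l : {ffun 'I_n -> bool}) : (x + \sum_j (l j)%:R * y j) ^+ 2 =
    z ^+ 2 + (z *+ 2) * (\sum_j centered y l j * 1) +
    \sum_j \sum_k centered y l j * centered y l k.
  have -> : x + \sum_j (l j)%:R * y j = z + \sum_j centered y l j.
    rewrite /z -addrA; congr (_ + _); rewrite mulr_suml -big_split/=.
    by apply: eq_bigr => j _; rewrite /centered; ring.
  under [in RHS]eq_bigr do rewrite mulr1.
  have -> : \sum_j \sum_k centered y l j * centered y l k =
      (\sum_j centered y l j) ^+ 2.
    by rewrite expr2 mulr_suml; apply: eq_bigr => j _; rewrite mulr_sumr.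
  by rewrite sqrrD mulrnAl.
under eq_bigr do rewrite expand.
have lin : \sum_l \sum_j centered y l j * 1 = 0.
  by rewrite exchange_big big1// => j _; exact: centered_bit_orthogonal.
have quad : \sum_l \sum_j \sum_k centered y l j * centered y l k =
    (\sum_j y j ^+ 2) / 4 * #|{: {ffun 'I_n -> bool}}|%:R.
  rewrite exchange_big/= !mulr_suml; apply: eq_bigr => j _.
  rewrite exchange_big/= (bigD1 j)//= [X in _ + X]big1 ?addr0; last first.
    move=> k kj; apply: centered_bit_orthogonal => l.
    by rewrite /centered ffunE (negbTE kj).
  rewrite (eq_bigr (fun=> y j ^+ 2 / 4)) ?sumr_const ?mulr_natr// => l _.
  by rewrite /centered; case: (l j) => /=; field.
rewrite -mulr_sumr !big_split/= -[X in _ + X + _]mulr_sumr lin quad sumr_const.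
rewrite mulr0 addr0 -[_ *+ #|_|]mulr_natr -mulrDl mulrCA.
by rewrite half_pow_bits_card mulr1.
Qed.

End bits_average.

(** * The Bernoulli part of a sum of lattice variables *)

Lemma lattice_point_inj (R : realType) (v0 D : R) : 0 < D ->
  injective (lattice_point v0 D).
Proof.
move=> D0 k k' /addrI /(mulfI (lt0r_neq0 D0)); exact: intr_inj.
Qed.

Section bernoulli_part.
Context (R : realType) (v0 D : R) (n : nat).
Context d (T : measurableType d) (P : probability T R) (X : 'I_n -> {RV P >-> R}).
Context d' (T' : measurableType d') (Q : probability T' R).
Variables (V eps : 'I_n -> {RV Q >-> R}) (th : 'I_n -> R).
Hypothesis D_gt0 : 0 < D.
Hypothesis X_indep : mutually_independent P (fun j w => X j w).
Hypothesis X_lattice : forall j, P (X j @^-1` lattice v0 D) = 1%E.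
Hypothesis Veps_indep : mutually_independent Q (fun j w => (V j w, eps j w)).
Hypothesis Veps_law :
  forall j, has_bernoulli_part_law v0 D (th j) (X j) (V j) (eps j).

Local Notation v := (lattice_point v0 D).
Local Notation tau j := (tau v0 D (X j) (th j)).

Definition grid_cell (u : {ffun 'I_n -> int}) : set T :=
  [set w | forall j, X j w = v (u j)].

(** The values of (V_j, eps_j) for which V_j + D eps_j l = v_k. *)
Definition bit_cell (l : bool) (k : int) : set (R * R) :=
  [set p | (p.1 = v k /\ p.2 = 0) \/ (p.1 = v (k - l%:Z) /\ p.2 = 1)].

Definition shifted_cell (l : {ffun 'I_n -> bool}) (u : {ffun 'I_n -> int}) :
    set T' :=
  [set w | forall j, bit_cell (l j) (u j) (V j w, eps j w)].

Lemma measurable_grid_cell u : measurable (grid_cell u).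
Proof.
apply: (@measurable_forall_fin _ _ _ (fun j => X j @^-1` [set v (u j)])) => j.
exact: measurable_funPTI.
Qed.

Lemma measurable_bit_cell l k : measurable (bit_cell l k).
Proof.
have -> : bit_cell l k =
    ([set v k] `*` [set 0]) `|` ([set v (k - l%:Z)] `*` [set 1]).
  by apply/seteqP; split=> -[x y].
by apply: measurableU; apply: measurableX.
Qed.

Let measurable_pair j : measurable_fun setT (fun w => (V j w, eps j w)).
Proof. by apply: measurable_fun_pair. Qed.

Lemma measurable_shifted_cell l u : measurable (shifted_cell l u).
Proof.
apply: (@measurable_forall_fin _ _ _
  (fun j => (fun w => (V j w, eps j w)) @^-1` bit_cell (l j) (u j))) => j.
rewrite -[X in measurable X]setTI; apply: measurable_pair => //.
exact: measurable_bit_cell.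
Qed.

Lemma trivIset_grid_cell : trivIset setT grid_cell.
Proof.
move=> u u' _ _ [w []] Hu Hu'; apply/ffunP => j.
by apply: (lattice_point_inj D_gt0 (v0 := v0)); rewrite -(Hu j) (Hu' j).
Qed.

Lemma trivIset_shifted_cell l : trivIset setT (shifted_cell l).
Proof.
move=> u u' _ _ [w []] Hu Hu'; apply/ffunP => j.
have inj := lattice_point_inj D_gt0 (v0 := v0).
have /eqP n01 : (0 : R) != 1 by rewrite eq_sym oner_eq0.
case: (Hu j) => -[/= V1 e1]; case: (Hu' j) => -[/= V2 e2].
- by apply: inj; rewrite -V1 -V2.
- by case: n01; rewrite -e1 -e2.
- by case: n01; rewrite -e1 -e2.
- by move: V1; rewrite V2 => /inj /addIr.
Qed.

(** Averaged over l, this is [lattice_pmf k]: the two values of l give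
    [tau k] and [tau (k - 1)], whose half sum cancels the subtracted term. *)
Lemma bit_cell_prob j l k :
  Q ((fun w => (V j w, eps j w)) @^-1` bit_cell l k) =
  (lattice_pmf v0 D (X j) k - (tau j (k - 1) + tau j k) / 2
    + tau j (k - l%:Z))%:E.
Proof.
have [_ Q0] := Veps_law j k; have [Q1 _] := Veps_law j (k - l%:Z).
have mV x : measurable (V j @^-1` [set x]) by exact: measurable_funPTI.
have me x : measurable (eps j @^-1` [set x]) by exact: measurable_funPTI.
rewrite EFinD -Q0 -Q1 -measureU//.
- exact: (measurableI _ _ (mV _) (me _)).
- exact: (measurableI _ _ (mV _) (me _)).
- apply/seteqP; split=> // w [] [_ /= e0] [_ e1].
  by have := oner_neq0 R; rewrite -e1 e0 eqxx.
Qed.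

(** Independence turns both sides into products over j, and the average over the
    words l of a product is the product of the averages over a single bit. *)
Lemma cell_mixture u :
  P (grid_cell u) =
  (\sum_(l : {ffun 'I_n -> bool}) ((2^-1) ^+ n)%:E * Q (shifted_cell l u))%E.
Proof.
have cE : grid_cell u =
    [set w | forall j, j \in index_enum 'I_n -> [set v (u j)] (X j w)].
  by apply/seteqP; split=> [w H j _|w H j]; [exact: H|exact: H (mem_index_enum j)].
have sE l : shifted_cell l u = [set w | forall j, j \in index_enum 'I_n ->
    bit_cell (l j) (u j) (V j w, eps j w)].
  by apply/seteqP; split=> [w H j _|w H j]; [exact: H|exact: H (mem_index_enum j)].
rewrite cE (X_indep (A := fun j => [set v (u j)])) ?index_enum_uniq//.
under [RHS]eq_bigr => l _.
  rewrite sE (Veps_indep (A := fun j => bit_cell (l j) (u j)))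
    ?index_enum_uniq//; last by move=> i; exact: measurable_bit_cell.
  under eq_bigr do rewrite bit_cell_prob.
  rewrite prodEFin -EFinM.
  over.
rewrite sumEFin -mulr_sumr.
transitivity (\prod_(j < n) (lattice_pmf v0 D (X j) (u j))%:E)%E.
  apply: eq_bigr => j _; rewrite /lattice_pmf /pmf fineK//.
  exact/fin_num_measure/measurable_funPTI.
rewrite prodEFin; congr (_%:E).
rewrite -[X in _ = _ ^+ X * _](card_ord n) -prodr_const.
rewrite -(bigA_distr_bigA (fun j (l : bool) =>
  lattice_pmf v0 D (X j) (u j) - (tau j (u j - 1) + tau j (u j)) / 2
    + tau j (u j - l%:Z))) -big_split/=.
apply: eq_bigr => j _; rewrite big_bool/= subr0; by field.
Qed.


Let measurable_lattice : measurable (lattice v0 D).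
Proof.
have -> : lattice v0 D = \bigcup_k [set v k].
  by apply/seteqP; split=> [x [k _ <-]|x [k _ ->]]; exists k.
exact: countable_bigcup_measurable.
Qed.

Lemma grid_cell_full : P (\bigcup_u grid_cell u) = 1%E.
Proof.
have -> : \bigcup_u grid_cell u =
    [set w | forall j, j \in index_enum 'I_n -> lattice v0 D (X j w)].
  apply/seteqP; split=> [w [u _ Hu] j _|w Hw]; first by exists (u j).
  have /choice[u Hu] : forall j, exists k, X j w = v k.
    by move=> j; have [k _ <-] := Hw j (mem_index_enum j); exists k.
  by exists [ffun j => u j] => // j; rewrite ffunE.
rewrite (X_indep (A := fun=> lattice v0 D)) ?index_enum_uniq//.
by rewrite big1.
Qed.

Let half_ge0 : 0 <= (2^-1 : R) ^+ n.
Proof. by rewrite exprn_ge0 ?invr_ge0. Qed.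

Lemma shifted_cell_full l : Q (\bigcup_u shifted_cell l u) = 1%E.
Proof.
exact: (mixture_full_mass half_ge0 (half_pow_bits_card R n)
  measurable_grid_cell measurable_shifted_cell trivIset_grid_cell
  trivIset_shifted_cell cell_mixture grid_cell_full).
Qed.

(** Testing the law of S against nonnegative functions keeps every integral defined
    and covers the two uses: the indicator of kappa, and the square of x - c. *)
Lemma bernoulli_part_integral (F : R -> R) : measurable_fun setT F ->
  (forall x, 0 <= F x) ->
  (\int[P]_w (F (\sum_j X j w))%:E =
   \sum_(l : {ffun 'I_n -> bool}) ((2^-1) ^+ n)%:E *
     \int[Q]_w (F (\sum_j (V j w + D * (l j)%:R * eps j w)))%:E)%E.
Proof.
move=> mF F0.
have mS : measurable_fun setT (fun w => F (\sum_j X j w)).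
  by apply: measurableT_comp => //; exact: measurable_sum.
have mS' (l : {ffun 'I_n -> bool}) : measurable_fun setT
    (fun w => F (\sum_j (V j w + D * (l j)%:R * eps j w))).
  apply: measurableT_comp => //; apply: measurable_sum => j.
  by apply: measurable_funD => //; apply: measurable_funM.
rewrite (full_measure_integral (countable_bigcup_measurable measurable_grid_cell)
  grid_cell_full); last 2 first.
- exact/measurable_EFinP.
- by move=> w; rewrite lee_fin.
rewrite (integral_mixture half_ge0
  measurable_grid_cell measurable_shifted_cell trivIset_grid_cell
  trivIset_shifted_cell cell_mixture (f := fun w => F (\sum_j X j w))
  (g := fun u => F (\sum_j v (u j)))
  (f' := fun l w => F (\sum_j (V j w + D * (l j)%:R * eps j w))))//.
- apply: eq_bigr => l _; congr (_ * _)%E.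
  rewrite [RHS](full_measure_integral
    (countable_bigcup_measurable (measurable_shifted_cell l))
    (shifted_cell_full l))//; last by move=> w; rewrite lee_fin.
  exact/measurable_EFinP.
- by move=> u w Hu; congr F; apply: eq_bigr => j _; exact: Hu.
- move=> l u w Hu; congr F; apply: eq_bigr => j _.
  case: (Hu j) => -[/= -> ->]; first by rewrite mulr0 addr0.
  by rewrite mulr1 /lattice_point intrB/=; ring.
Qed.

(** The law hypothesis speaks of lattice points and of the values 0 and 1 only;
    that nothing else has positive mass follows from [shifted_cell_full]. *)
Lemma bernoulli_part_ae :
  {ae Q, forall w, exists (k : 'I_n -> int) (e : 'I_n -> bool),
    forall j, V j w = v (k j) /\ eps j w = (e j)%:R}.
Proof.
have mU := countable_bigcup_measurable (measurable_shifted_cell [ffun=> false]).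
apply: filterS (full_measure_ae mU (shifted_cell_full _)) => w [u _ Hu].
have /choice[e He] : forall j, exists e : bool,
    V j w = v (u j) /\ eps j w = e%:R.
  move=> j; case: (Hu j) => -[/= Vj ej]; first by exists false.
  by exists true; move: Vj; rewrite ffunE subr0.
by exists u, e.
Qed.

(** A positive [vartheta] is a finite sum, as [fine] sends an infinite one to 0;
    so the masses [tau k] add up to th_j. *)
Lemma eps_prob1 j : 0 < vartheta v0 D (X j) -> 0 < th j ->
  Q [set w | eps j w = 1] = (th j)%:E.
Proof.
move=> vt0 th0.
have mV k : measurable (V j @^-1` [set v k]) by exact: measurable_funPTI.
have me : measurable (eps j @^-1` [set 1]) by exact: measurable_funPTI.
pose G k := [set w | V j w = v k /\ eps j w = 1].
have mG k : measurable (G k) by exact: (measurableI _ _ (mV k) me).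
have -> : Q [set w | eps j w = 1] = Q (\bigcup_k G k).
  apply: ae_eq_measure => //; first exact: countable_bigcup_measurable.
  apply: filterS bernoulli_part_ae => w [k [e He]]; split=> [ew|[k' _ []]//].
  by exists (k j) => //; split=> //; have [] := He j.
rewrite (measure_countable_bigcup Q mG); last first.
  move=> k k' _ _ [w [[Vk _] [Vk' _]]].
  by apply: (lattice_point_inj D_gt0 (v0 := v0)); rewrite -Vk.
have QG k : Q (G k) = (tau j k)%:E := (Veps_law j k).1.
rewrite (eq_esum (b := fun k => ((th j / vartheta v0 D (X j))%:E *
  (Num.min (lattice_pmf v0 D (X j) k) (lattice_pmf v0 D (X j) (k + 1)))%:E)%E));
  last by move=> k _; rewrite -EFinM; exact: QG.
have vt : \esum_(k in [set: int])
    (Num.min (lattice_pmf v0 D (X j) k) (lattice_pmf v0 D (X j) (k + 1)))%:E =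
    (vartheta v0 D (X j))%:E.
  move: vt0; rewrite /vartheta; case: (esum _ _) => [r| |]//=; by rewrite ltxx.
rewrite ge0_esumZl; last 2 first.
- by rewrite divr_ge0 ?ltW.
- by move=> k; rewrite lee_fin le_min !pmf_ge0.
by rewrite vt -EFinM divfK// gt_eqF.
Qed.

End bernoulli_part.

(** * Gaussian bumps and the Kolmogorov distance *)

Lemma bounded_integral_fin_num d (T : measurableType d) (R : realType)
    (P : probability T R) (f : T -> R) :
  measurable_fun setT f -> (forall w, 0 <= f w <= 1) ->
  (\int[P]_w (f w)%:E)%E \is a fin_num.
Proof.
move=> mf f01; rewrite ge0_fin_numE; last first.
  by apply: integral_ge0 => w _; rewrite lee_fin; case/andP: (f01 w).
apply: (@le_lt_trans _ _ (\int[P]_w (cst 1%E w))%E).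
  apply: ge0_le_integral => //.
  - by move=> w _; rewrite lee_fin; case/andP: (f01 w).
  - exact/measurable_EFinP.
  - by move=> w _; rewrite lee_fin; case/andP: (f01 w).
by rewrite integral_cst//= probability_setT mule1 ltry.
Qed.

Lemma complete_square (F : numFieldType) (x c t : F) : t != 0 -> t + 1 != 0 ->
  - (x - c) ^+ 2 / (t *+ 2) + - x ^+ 2 / (1 *+ 2) =
  - c ^+ 2 / ((t + 1) *+ 2) + - (x - c / (t + 1)) ^+ 2 / ((t / (t + 1)) *+ 2).
Proof. by move=> t0 t1; rewrite !mulr2n; field; rewrite t1 -!mulr2n !mulrn_eq0 !negb_or t0 t1. Qed.

Section gaussian_bump.
Context (R : realType).
Local Notation mu := lebesgue_measure.
Local Notation gamma := (normal_prob (0 : R) 1).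

(** The normal density is a version of the Radon-Nikodym derivative of the normal
    law, whose change of variables formula then applies. *)
Lemma integral_normal_prob (m s : R) (f : R -> R) :
  measurable_fun setT f -> (forall x, 0 <= f x <= 1) ->
  (\int[normal_prob m s]_x (f x)%:E = \int[mu]_x (f x * normal_pdf m s x)%:E)%E.
Proof.
move=> mf f01.
have fint : (normal_prob m s).-integrable setT (fun x => (f x)%:E).
  apply: (@le_integrable _ _ _ _ _ measurableT _ (cst 1%E)) => //.
  - exact/measurable_EFinP.
  - move=> x _ /=; have /andP[f0 f1] := f01 x.
    by rewrite lee_fin !ger0_norm.
  - apply/integrableP; split => //.
    under eq_integral do rewrite abse1.
    by rewrite integral_cst//= probability_setT mule1 ltry.
have dom := normal_prob_dominates m s.
rewrite -(Radon_Nikodym_change_of_variables dom measurableT fint)/=.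
under [RHS]eq_integral do rewrite EFinM.
apply: ae_eq_integral => //.
- apply: emeasurable_funM; first exact/measurable_EFinP.
  by apply: (measurable_int mu); apply: Radon_Nikodym_integrable.
- apply: emeasurable_funM; first exact/measurable_EFinP.
  by apply/measurable_EFinP; exact: measurable_normal_pdf.
- apply: ae_eqe_mul2l => /=.
  apply: integral_ae_eq => //=.
  + exact: Radon_Nikodym_integrable.
  + by apply/measurable_EFinP; exact: measurable_normal_pdf.
  + by move=> E _ mE; rewrite -Radon_Nikodym_integral.
Qed.

Lemma normal_fun_le1 (m s x : R) : normal_fun m s x <= 1.
Proof.
rewrite /normal_fun -expR0 ler_expR mulNr oppr_le0 divr_ge0 ?sqr_ge0//.
by rewrite mulrn_wge0// sqr_ge0.
Qed.

(** Completing the square, the product of the bump and of the standard normal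
    density is a constant times another normal density. *)
Lemma integral_bump_normal (c s : R) : 0 < s ->
  (\int[gamma]_x (normal_fun c s x)%:E =
   (s / Num.sqrt (s ^+ 2 + 1) * normal_fun c (Num.sqrt (s ^+ 2 + 1)) 0)%:E)%E.
Proof.
move=> s0; set q := Num.sqrt _.
have q2 : q ^+ 2 = s ^+ 2 + 1 by rewrite sqr_sqrtr// addr_ge0// sqr_ge0.
have q0 : 0 < q by rewrite sqrtr_gt0 ltr_wpDl// sqr_ge0.
have s'0 : 0 < s / q by rewrite divr_gt0.
rewrite integral_normal_prob; last 2 first.
- exact: measurable_normal_fun.
- by move=> x; rewrite normal_fun_ge0 normal_fun_le1.
transitivity (\int[mu]_x ((s / q * normal_fun c q 0)%:E *
    (normal_pdf (c / q ^+ 2) (s / q) x)%:E))%E.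
  apply: eq_integral => x _; rewrite -EFinM; congr (_%:E).
  rewrite !normal_pdfE ?gt_eqF//.
  have -> : normal_peak (s / q) = normal_peak 1 / (s / q).
    rewrite /normal_peak expr1n mul1r -mulrnAr (sqrtrM _ (sqr_ge0 _)).
    by rewrite sqrtr_sqr gtr0_norm// invfM mulrC.
  have key : normal_fun c s x * normal_fun 0 1 x =
      normal_fun c q 0 * normal_fun (c / q ^+ 2) (s / q) x.
    rewrite /normal_fun -!expRD; congr expR.
    rewrite expr_div_n q2 expr1n sub0r subr0 sqrrN.
    by apply: complete_square; rewrite gt_eqF ?exprn_gt0// ltr_wpDl// sqr_ge0.
  by rewrite mulrCA key; field; rewrite !gt_eqF.
rewrite ge0_integralZl//.
- by rewrite integral_normal_pdf mule1.
- by apply/measurable_EFinP; exact: measurable_normal_pdf.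
- by move=> x _; rewrite lee_fin normal_pdf_ge0.
- by rewrite lee_fin mulr_ge0 ?normal_fun_ge0 ?ltW.
Qed.

End gaussian_bump.

Section interval_probability.
Context d (T : measurableType d) (R : realType) (P : probability T R).
Variable Y : T -> R.
Hypothesis mY : measurable_fun setT Y.

Let mlt x : measurable [set w | Y w < x].
Proof.
have -> : [set w | Y w < x] = Y @^-1` `]-oo, x[.
  by apply/seteqP; split=> w /=; rewrite in_itv.
by rewrite -[X in measurable X]setTI; exact: mY.
Qed.

Let mco a b : measurable [set w | a <= Y w < b].
Proof.
have -> : [set w | a <= Y w < b] = Y @^-1` `[a, b[.
  by apply/seteqP; split=> w /=; rewrite in_itv.
by rewrite -[X in measurable X]setTI; exact: mY.
Qed.

Lemma prob_co a b : a <= b -> fine (P [set w | a <= Y w < b]) =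
  fine (P [set w | Y w < b]) - fine (P [set w | Y w < a]).
Proof.
move=> ab.
have -> : [set w | Y w < b] = [set w | Y w < a] `|` [set w | a <= Y w < b].
  apply/seteqP; split=> w /=.
    by move=> wb; case: (ltP (Y w) a) => wa; [left|right].
  by move=> [wa|/andP[]//]; exact: lt_le_trans ab.
rewrite measureU//; last first.
  apply/seteqP; split=> // w /= [wa /andP[aw _]].
  by have := lt_le_trans wa aw; rewrite ltxx.
by rewrite fineD ?fin_num_measure// addrC addKr.
Qed.

Lemma fine_prob_le (A B : set T) : measurable A -> measurable B -> A `<=` B ->
  fine (P A) <= fine (P B).
Proof.
by move=> mA mB AB; rewrite fine_le ?fin_num_measure// le_measure ?inE.
Qed.

Lemma prob_oo_ge a b e : 0 < e ->
  fine (P [set w | Y w < b]) - fine (P [set w | Y w < a + e]) <=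
  fine (P [set w | a < Y w < b]).
Proof.
move=> e0.
have moo : measurable [set w | a < Y w < b].
  have -> : [set w | a < Y w < b] = Y @^-1` `]a, b[.
    by apply/seteqP; split=> w /=; rewrite in_itv.
  by rewrite -[X in measurable X]setTI; exact: mY.
have [aeb|bae] := leP (a + e) b; last first.
  rewrite (le_trans _ (fine_ge0 _))// subr_le0.
  apply: fine_prob_le => // w /= wb; exact: lt_trans bae.
rewrite -prob_co//; apply: fine_prob_le => // w /= /andP[aw ->].
by rewrite andbT (lt_le_trans _ aw)// ltrDl.
Qed.

Lemma prob_oo_le a b : a <= b -> fine (P [set w | a < Y w < b]) <=
  fine (P [set w | Y w < b]) - fine (P [set w | Y w < a]).
Proof.
move=> ab; rewrite -prob_co//; apply: fine_prob_le => //.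
  have -> : [set w | a < Y w < b] = Y @^-1` `]a, b[.
    by apply/seteqP; split=> w /=; rewrite in_itv.
  by rewrite -[X in measurable X]setTI; exact: mY.
by move=> w /= /andP[/ltW -> ->].
Qed.

End interval_probability.

Section kolmogorov_distance.
Context d d' (T : measurableType d) (T' : measurableType d') (R : realType).
Variables (P : probability T R) (Q : probability T' R).
Variables (Y : T -> R) (Z : T' -> R).
Hypothesis mY : measurable_fun setT Y.
Hypothesis mZ : measurable_fun setT Z.
Variables (H K : R).
Hypothesis YZ : forall x,
  `|fine (P [set w | Y w < x]) - fine (Q [set w | Z w < x])| <= H.
Hypothesis K_ge0 : 0 <= K.
Hypothesis Z_lip : forall x e, 0 < e ->
  fine (Q [set w | Z w < x + e]) - fine (Q [set w | Z w < x]) <= K * e.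

(** The distance only compares probabilities of half-lines Y < x, hence of
    intervals [a, b[.  An open interval is squeezed between [a, b[ and
    [a + e, b[, and the Lipschitz bound on the law of Z makes the loss at the
    left end vanish with e. *)
Lemma kolmogorov_open_interval a b : a <= b ->
  `|fine (P [set w | a < Y w < b]) - fine (Q [set w | a < Z w < b])| <= 2 * H.
Proof.
move=> ab; apply/ler_addgt0Pr => e e0.
have K1 : 0 < K + 1 by rewrite ltr_wpDl.
(* Dividing by K + 1 rather than by K covers K = 0. *)
pose e' := e / (K + 1); have e'0 : 0 < e' by rewrite divr_gt0.
have Ke : K * e' <= e by rewrite /e' mulrCA ler_piMr ?ltW// ltr_pdivrMr// mul1r ltrDl.
have Pup := prob_oo_le P mY ab; have Qup := prob_oo_le Q mZ ab.
have Plo := prob_oo_ge P mY a b e'0; have Qlo := prob_oo_ge Q mZ a b e'0.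
have lip := Z_lip a e'0.
have := YZ a; have := YZ b; have := YZ (a + e').
rewrite !ler_norml => /andP[? ?] /andP[? ?] /andP[? ?].
by apply/andP; split; lra.
Qed.

End kolmogorov_distance.

Section normal_cdf.
Context (R : realType).
Local Notation gamma := (normal_prob (0 : R) 1).

(** The density never exceeds its peak. *)
Lemma normal_cdf_lipschitz (x e : R) : 0 < e ->
  fine (gamma [set y | y < x + e]) - fine (gamma [set y | y < x]) <=
  normal_peak 1 * e.
Proof.
move=> e0; rewrite -(prob_co gamma (Y := id))//; last by rewrite lerDl ltW.
have -> : [set y : R | x <= y < x + e] = `[x, x + e[%classic.
  by apply/seteqP; split=> y /=; rewrite in_itv.
rewrite -lee_fin fineK ?fin_num_measure//.
apply: (@le_trans _ _ (\int[lebesgue_measure]_(y in `[x, (x + e)%R[)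
    (normal_peak (1 : R))%:E)%E).
  apply: ge0_le_integral => //.
  - by move=> y _; rewrite lee_fin normal_pdf_ge0.
  - by apply: measurable_funTS; apply/measurable_EFinP; exact: measurable_normal_pdf.
  - by move=> y _; rewrite lee_fin normal_pdf_ub// oner_eq0.
have len : @lebesgue_measure R `[x, x + e[%classic = e%:E.
  by rewrite lebesgue_measure_itv/= lte_fin ltrDl e0 -EFinD addrAC subrr add0r.
rewrite integral_cst// EFinM; apply: lee_wpmul2l; last first.
  by rewrite le_eqVlt; apply/orP; left; apply/eqP; exact: len.
by rewrite lee_fin normal_peak_ge0.
Qed.

End normal_cdf.

Section layer_cake.
Context d d' (T : measurableType d) (T' : measurableType d') (R : realType).
Variables (P : probability T R) (Q : probability T' R).

(** The tail formula for expectations.  The bound is asked for 0 < t < 1 only: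
    t = 0 is negligible, and above 1 the tail of A is zero, which is why del
    enters once. *)
Lemma expectation_ccdf_le (A : {RV P >-> R}) (B : {RV Q >-> R}) (del : R) :
  (forall w, 0 <= A w <= 1) -> (forall w, 0 <= B w <= 1) -> 0 <= del ->
  (forall t, 0 < t < 1 -> fine (P [set w | t < A w]) <=
     fine (Q [set w | t < B w]) + del) ->
  (\int[P]_w (A w)%:E <= \int[Q]_w (B w)%:E + del%:E)%E.
Proof.
move=> A01 B01 del0 AB.
rewrite -!expectation_def !ge0_expectation_ccdf; last 2 first.
- by move=> w; case/andP: (B01 w).
- by move=> w; case/andP: (A01 w).
have -> : del%:E = (\int[lebesgue_measure]_(t in `[0%R, +oo[)
    (del%:E * (\1_(`]0%R, 1%R[%classic : set R) t)%:E))%E.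
  rewrite ge0_integralZl//; last first.
    by apply: measurable_funTS; apply/measurable_EFinP; exact: measurable_indic.
  rewrite integral_indic//.
  rewrite (_ : _ `&` _ = `]0%R, 1%R[%classic); last first.
    by apply/seteqP; split=> t /=; rewrite !in_itv/= ?andbT; lra.
  have len : @lebesgue_measure R `]0%R, 1%R[%classic = 1%E.
    by rewrite lebesgue_measure_itv/= lte01 oppr0 adde0.
  by rewrite -[LHS]mule1; congr (_ * _)%E; apply/esym; exact: len.
have mccdf d1 (T1 : measurableType d1) (M : probability T1 R) (C : {RV M >-> R}) :
    measurable_fun (`[0%R, +oo[%classic : set R) (ccdf C).
  by apply: measurable_funTS; exact: ccdf_measurable.
have mind : measurable_fun (`[0%R, +oo[%classic : set R)
    (fun t : R => (del%:E * (\1_(`]0%R, 1%R[%classic : set R) t)%:E)%E).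
  apply: measurable_funTS; apply: emeasurable_funM => //.
  by apply/measurable_EFinP; exact: measurable_indic.
rewrite -ge0_integralD//; last 2 first.
- exact: mccdf.
- by move=> t _; rewrite -EFinM lee_fin mulr_ge0.
apply: ae_ge0_le_integral => //.
- exact: mccdf.
- by move=> t _; rewrite adde_ge0// -EFinM lee_fin mulr_ge0.
- by apply: emeasurable_funD => //; exact: mccdf.
have ccdfE d1 (T1 : measurableType d1) (M : probability T1 R) (C : {RV M >-> R}) t :
    ccdf C t = (fine (M [set w | t < C w]))%:E.
  rewrite fineK; last first.
    apply: fin_num_measure.
    have -> : [set w | t < C w] = C @^-1` `]t, +oo[.
      by apply/seteqP; split=> w /=; rewrite in_itv/= andbT.
    exact: measurable_funPTI.
  rewrite /ccdf /distribution /pushforward; congr (M _).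
  by apply/seteqP; split=> w /=; rewrite in_itv/= andbT.
exists [set 0]; split => //; first exact: lebesgue_measure_set1.
move=> t /=; apply: contra_notP => /eqP t0; rewrite in_itv/= andbT => t_ge0.
have {t0 t_ge0}t0 : 0 < t by rewrite lt_neqAle eq_sym t0.
rewrite !ccdfE -EFinM -EFinD lee_fin indicE.
have [t1|t1] := ltP t 1.
  by rewrite mem_set ?mulr1 ?AB ?t0//= in_itv/= t0.
rewrite memNset/=; last by rewrite in_itv/= t0/= ltNge t1.
rewrite mulr0 addr0.
have -> : [set w | t < A w] = set0.
  apply/seteqP; split=> // w /=; have /andP[_ A1] := A01 w.
  by rewrite ltNge (le_trans A1).
by rewrite measure0 fine_ge0.
Qed.

End layer_cake.

Section bump_comparison.
Context d d' (T : measurableType d) (T' : measurableType d') (R : realType).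
Variables (P : probability T R) (Q : probability T' R).

Lemma bump_superlevel (c s t y : R) : 0 < s -> 0 < t < 1 ->
  (t < normal_fun c s y) =
  (c - Num.sqrt (- ln t * (s ^+ 2 *+ 2)) < y < c + Num.sqrt (- ln t * (s ^+ 2 *+ 2))).
Proof.
move=> s0 /andP[t0 t1]; set r := Num.sqrt _.
have s2 : 0 < s ^+ 2 *+ 2 by rewrite pmulrn_lgt0// exprn_gt0.
have lnt : 0 < - ln t by rewrite oppr_gt0 ln_lt0// t0.
have -> : (c - r < y < c + r) = (`|y - c| < r).
  by rewrite ltr_norml; apply/idP/idP; lra.
rewrite -[RHS]ltr_sqr ?nnegrE ?sqrtr_ge0//.
rewrite real_normK ?num_real// sqr_sqrtr ?mulr_ge0 ?ltW//.
rewrite -[t in LHS]lnK ?posrE// /normal_fun ltr_expR.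
by rewrite mulNr ltrNr ltr_pdivrMr.
Qed.

Lemma bump_expectation_le (Y : T -> R) (Z : T' -> R) (c s del : R) :
  measurable_fun setT Y -> measurable_fun setT Z -> 0 < s -> 0 <= del ->
  (forall a b, a <= b ->
     fine (P [set w | a < Y w < b]) <= fine (Q [set w | a < Z w < b]) + del) ->
  fine (\int[P]_w (normal_fun c s (Y w))%:E) <=
  fine (\int[Q]_w (normal_fun c s (Z w))%:E) + del.
Proof.
move=> mY mZ s0 del0 YZ.
have mb d1 (T1 : measurableType d1) (f : T1 -> R) : measurable_fun setT f ->
    measurable_fun setT (fun w => normal_fun c s (f w)).
  by move=> mf; apply: measurableT_comp => //; exact: measurable_normal_fun.
pose A : {RV P >-> R} :=
  HB.pack (fun w => normal_fun c s (Y w)) (@isMeasurableFun.Build _ _ _ _ _ (mb _ _ _ mY)).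
pose B : {RV Q >-> R} :=
  HB.pack (fun w => normal_fun c s (Z w)) (@isMeasurableFun.Build _ _ _ _ _ (mb _ _ _ mZ)).
have b01 y : 0 <= normal_fun c s y <= 1 by rewrite normal_fun_ge0 normal_fun_le1.
have := @expectation_ccdf_le _ _ _ _ _ P Q A B del (fun w => b01 _) (fun w => b01 _) del0.
rewrite /A/B/= => AB.
rewrite -lee_fin EFinD !fineK; last 2 first.
- by apply: bounded_integral_fin_num => //; exact: (mb _ _ _ mZ).
- by apply: bounded_integral_fin_num => //; exact: (mb _ _ _ mY).
apply: AB => t t01.
have setE (T1 : Type) (f : T1 -> R) : [set w | t < normal_fun c s (f w)] =
    [set w | c - Num.sqrt (- ln t * (s ^+ 2 *+ 2)) < f w <
             c + Num.sqrt (- ln t * (s ^+ 2 *+ 2))].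
  by apply/seteqP; split=> w /=; rewrite bump_superlevel.
rewrite !setE; apply: YZ.
by rewrite lerD2l ge0_cp// sqrtr_ge0.
Qed.

End bump_comparison.

Section normal_distance.
Context d (T : measurableType d) (R : realType) (P : probability T R).
Variable S : T -> R.
Hypothesis mS : measurable_fun setT S.
Local Notation gamma := (normal_prob (0 : R) 1).
Local Notation m := (esp P S).
Local Notation sigma := (Num.sqrt (var P S)).
Local Notation Y := (fun w => (S w - m) / sigma).

Let mY : measurable_fun setT Y.
Proof. by apply: measurable_funM => //; exact: measurable_funB. Qed.

Lemma normal_distance_ub x :
  `|fine (P [set w | Y w < x]) - fine (gamma [set y | y < x])| <=
  normal_distance P S.
Proof.
have itvE z : [set y : R | y < z] = `]-oo, z[%classic.
  by apply/seteqP; split=> y /=; rewrite in_itv.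
rewrite itvE; apply: sup_upper_bound; last by exists x.
split; first by exists (`|fine (P [set w | Y w < 0]) -
  fine (gamma `]-oo, 0%R[)|), 0.
have p01 d1 (T1 : measurableType d1) (M : probability T1 R) A : measurable A ->
    0 <= fine (M A) <= 1.
  move=> mA; rewrite fine_ge0//= -lee_fin fineK ?fin_num_measure//.
  exact: probability_le1.
exists 1 => _ [z _ <-].
have mA : measurable [set w | Y w < z].
  rewrite (_ : [set w | Y w < z] = Y @^-1` `]-oo, z[).
    by rewrite -[X in measurable X]setTI; exact: mY.
  by apply/seteqP; split=> w /=; rewrite in_itv.
have /andP[a0 a1] := p01 _ _ P _ mA.
have /andP[b0 b1] : 0 <= fine (gamma `]-oo, z[%classic) <= 1 by apply: p01.
by rewrite ler_norml; apply/andP; split; lra.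
Qed.

Lemma normal_distance_ge0 : 0 <= normal_distance P S.
Proof. by apply: le_trans (normal_distance_ub 0); exact: normr_ge0. Qed.

(** The superlevel sets of the bump, at levels between 0 and 1, are open intervals,
    on which the two laws differ by at most twice the Kolmogorov distance. *)
Lemma standardized_bump (c s : R) : 0 < s ->
  `|fine (\int[P]_w (normal_fun c s (Y w))%:E) -
    s / Num.sqrt (s ^+ 2 + 1) * normal_fun c (Num.sqrt (s ^+ 2 + 1)) 0| <=
  2 * normal_distance P S.
Proof.
move=> s0.
have -> : s / Num.sqrt (s ^+ 2 + 1) * normal_fun c (Num.sqrt (s ^+ 2 + 1)) 0 =
    fine (\int[gamma]_y (normal_fun c s y)%:E).
  by rewrite integral_bump_normal.
have close a b : a <= b -> `|fine (P [set w | a < Y w < b]) -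
    fine (gamma [set y | a < y < b])| <= 2 * normal_distance P S.
  move=> ab; apply: (@kolmogorov_open_interval _ _ _ _ _ P gamma Y id mY _
    _ _ normal_distance_ub (normal_peak_ge0 (1 : R))) => //.
  by move=> x e; exact: normal_cdf_lipschitz.
have H0 : 0 <= 2 * normal_distance P S by rewrite mulr_ge0 ?normal_distance_ge0.
rewrite ler_norml; apply/andP; split.
- rewrite lerBrDl lerBlDr.
  apply: (@bump_expectation_le _ _ _ _ _ gamma P id Y) => // a b ab.
  by have := close a b ab; rewrite ler_norml => /andP[+ _]; lra.
- rewrite lerBlDl.
  apply: (@bump_expectation_le _ _ _ _ _ P gamma Y id) => // a b ab.
  by have := close a b ab; rewrite ler_norml => /andP[_]; lra.
Qed.

End normal_distance.

Section second_moment.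
Context d (T : measurableType d) (R : realType) (P : probability T R).

Lemma second_moment_Lfun2 (S : T -> R) : measurable_fun setT S ->
  (\int[P]_w (S w ^+ 2)%:E < +oo)%E -> S \in Lfun P 2%:E.
Proof.
move=> mS S2; rewrite inE; apply/andP; split; rewrite inE//=.
rewrite /finite_norm unlock; apply: poweR_lty.
apply: le_lt_trans S2; rewrite le_eqVlt; apply/orP; left; apply/eqP.
by apply: eq_integral => w _ /=; rewrite powR_mulrn// real_normK ?num_real.
Qed.

Lemma second_moment_about (S : T -> R) (c : R) : S \in Lfun P 2%:E ->
  (\int[P]_w ((S w - c) ^+ 2)%:E = (var P S + (esp P S - c) ^+ 2)%:E)%E.
Proof.
move=> S2.
have cst2 : cst c \in Lfun P 2%:E by exact: Lfun_cst.
have S1 : S \in Lfun P 1 by apply: (Lfun_subset12 (fin_num_measure P _ measurableT)).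
have cst1 : cst c \in Lfun P 1.
  by apply: (Lfun_subset12 (fin_num_measure P _ measurableT)).
have Sc2 : S \- cst c \in Lfun P 2%:E by rewrite rpredB ?lee1n.
have := varianceE Sc2; rewrite varianceB_cst_r// expectationB// expectation_cst.
have -> : ('E_P[((S \- cst c) ^+ 2)%R])%E = (\int[P]_w ((S w - c) ^+ 2)%:E)%E.
  by rewrite unlock.
have iSc : (\int[P]_w ((S w - c) ^+ 2)%:E)%E \is a fin_num.
  by apply: integrable_fin_num => //; exact: Lfun2_integrable_sqr.
rewrite /var /esp -(fineK (variance_fin_num S2)) -(fineK (expectation_fin_num S1)).
rewrite -(fineK iSc)/=.
rewrite -EFinD => -[->].
by rewrite expr2 subrK.
Qed.

End second_moment.

Section bump.
Context d (T : measurableType d) (R : realType) (P : probability T R).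
Variable S : T -> R.
Hypothesis S2 : S \in Lfun P 2%:E.
Let mS : measurable_fun setT S.
Proof. by move: S2; rewrite inE => /andP[]; rewrite inE. Qed.

Lemma var_ge0 : 0 <= var P S.
Proof. by rewrite fine_ge0// variance_ge0. Qed.

(** When Var S = 0 the standardization divides by 0 and gives no information; but
    then S is almost surely its mean, and the two terms are equal. *)
Lemma integral_bump_normal_distance (c a : R) : 0 < a ->
  `|fine (\int[P]_w (expR (- ((c - S w) ^+ 2 / (2 * a ^+ 2))))%:E) -
    a / Num.sqrt (a ^+ 2 + var P S) *
      expR (- ((c - esp P S) ^+ 2 / (2 * (a ^+ 2 + var P S))))| <=
  2 * normal_distance P S.
Proof.
move=> a0; set m := esp P S; set v := var P S.
have [v0|v0] := eqVneq v 0.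
  rewrite v0 addr0 sqrtr_sqr (gtr0_norm a0) divff ?gt_eqF// mul1r.
  have -> : (\int[P]_w (expR (- ((c - S w) ^+ 2 / (2 * a ^+ 2))))%:E =
      \int[P]_w (cst (expR (- ((c - m) ^+ 2 / (2 * a ^+ 2))))%:E w))%E.
    apply: ae_eq_integral => //.
      apply/measurable_EFinP; apply: measurableT_comp => //.
      apply: measurableT_comp => //; apply: measurable_funM => //.
      by apply: measurable_funX; exact: measurable_funB.
    have : (\int[P]_w `|((S w - m) ^+ 2)%:E| = 0)%E.
      rewrite -[RHS](_ : (v + (m - m) ^+ 2)%:E = _); last first.
        by rewrite v0 subrr expr0n addr0.
      rewrite -(second_moment_about _ S2); apply: eq_integral => w _.
      by rewrite gee0_abs// lee_fin sqr_ge0.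
    have mS2 : measurable_fun setT (fun w => ((S w - m) ^+ 2)%:E).
      by apply/measurable_EFinP; apply: measurable_funX; exact: measurable_funB.
    move/(ae_eq_integral_abs _ measurableT mS2).
    apply: filterS => w /(_ I) [/eqP]; rewrite sqrf_eq0 subr_eq0 => /eqP Sw _.
    by rewrite /= Sw.
  rewrite integral_cst//= probability_setT mule1 subrr normr0.
  by rewrite mulr_ge0 ?normal_distance_ge0.
have {v0}v0 : 0 < v by rewrite lt_neqAle eq_sym v0 var_ge0.
pose s := Num.sqrt v; have s0 : 0 < s by rewrite sqrtr_gt0.
have s2 : s ^+ 2 = v by rewrite sqr_sqrtr// ltW.
have as0 : 0 < a / s by rewrite divr_gt0.
have := standardized_bump P mS ((c - m) / s) as0.
have av0 : 0 < a ^+ 2 + v by rewrite addr_gt0// exprn_gt0.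
have -> : Num.sqrt ((a / s) ^+ 2 + 1) = Num.sqrt (a ^+ 2 + v) / s.
  rewrite -[RHS](ger0_norm (divr_ge0 (sqrtr_ge0 _) (ltW s0))) -sqrtr_sqr.
  congr Num.sqrt; rewrite !expr_div_n s2 (sqr_sqrtr (ltW av0)) mulrDl.
  by rewrite divff ?gt_eqF.
have -> : a / s / (Num.sqrt (a ^+ 2 + v) / s) = a / Num.sqrt (a ^+ 2 + v).
  have q0 : Num.sqrt (a ^+ 2 + v) != 0 by rewrite gt_eqF// sqrtr_gt0.
  by field; rewrite q0 gt_eqF.
have -> : normal_fun ((c - m) / s) (Num.sqrt (a ^+ 2 + v) / s) 0 =
    expR (- ((c - m) ^+ 2 / (2 * (a ^+ 2 + v)))).
  rewrite /normal_fun expr_div_n sub0r sqrrN s2 (sqr_sqrtr (ltW av0)).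
  congr expR; rewrite expr_div_n s2 -(mulr_natr ((a ^+ 2 + v) / v) 2).
  by field; rewrite !gt_eqF.
under eq_integral => w _.
  rewrite (_ : normal_fun _ _ _ = expR (- ((c - S w) ^+ 2 / (2 * a ^+ 2)))); last first.
    rewrite /normal_fun -mulrBl !expr_div_n -[Num.sqrt (var P S)]/s -/m.
    congr expR; rewrite s2 -(mulr_natr (a ^+ 2 / v) 2).
    by field; rewrite !gt_eqF.
  over.
by [].
Qed.

End bump.

(** * First and second moments *)

Section bernoulli_part_moments.
Context (R : realType) (v0 D : R) (n : nat).
Context d (T : measurableType d) (P : probability T R) (X : 'I_n -> {RV P >-> R}).
Context d' (T' : measurableType d') (Q : probability T' R).
Variables (V eps : 'I_n -> {RV Q >-> R}) (th : 'I_n -> R).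
Hypothesis D_gt0 : 0 < D.
Hypothesis X_indep : mutually_independent P (fun j w => X j w).
Hypothesis X_lattice : forall j, P (X j @^-1` lattice v0 D) = 1%E.
Hypothesis Veps_indep : mutually_independent Q (fun j w => (V j w, eps j w)).
Hypothesis Veps_law :
  forall j, has_bernoulli_part_law v0 D (th j) (X j) (V j) (eps j).
Hypothesis X_L2 : forall j, (X j : T -> R) \in Lfun P 2%:E.
Hypothesis X_vartheta : forall j, 0 < vartheta v0 D (X j).
Hypothesis th_gt0 : forall j, 0 < th j.

Local Notation S := (fun w => \sum_(j < n) X j w).
Local Notation B := (fun w => \sum_(j < n) eps j w).
Local Notation S' := (fun w => \sum_(j < n) V j w + D / 2 * \sum_(j < n) eps j w).
Local Notation Theta := (\sum_(j < n) th j).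

Lemma bernoulli_part_average (F : R -> R) : measurable_fun setT F ->
  (forall x, 0 <= F x) ->
  (\int[P]_w (F (S w))%:E =
   \int[Q]_w (\sum_(l : {ffun 'I_n -> bool})
     (2^-1) ^+ n * F (\sum_j (V j w + D * (l j)%:R * eps j w)))%:E)%E.
Proof.
move=> mF F0.
rewrite (bernoulli_part_integral D_gt0 X_indep X_lattice Veps_indep Veps_law)//.
have mFl (l : {ffun 'I_n -> bool}) : measurable_fun setT
    (fun w => (F (\sum_j (V j w + D * (l j)%:R * eps j w)))%:E).
  apply/measurable_EFinP; apply: measurableT_comp => //.
  apply: measurable_sum => j.
  by apply: measurable_funD => //; apply: measurable_funM.
have a0 : 0 <= (2^-1 : R) ^+ n by rewrite exprn_ge0 ?invr_ge0.
under [RHS]eq_integral do rewrite -sumEFin.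
rewrite ge0_integral_sum//; last 2 first.
- by move=> l; under eq_fun do rewrite EFinM; exact: emeasurable_funM.
- by move=> l w _; rewrite lee_fin mulr_ge0.
apply: eq_bigr => l _; under [RHS]eq_integral do rewrite EFinM.
by rewrite ge0_integralZl// => w _; rewrite lee_fin.
Qed.

Lemma eps_second_moment j : (\int[Q]_w (eps j w ^+ 2)%:E = (th j)%:E)%E.
Proof.
have m1 : measurable [set w | eps j w = 1].
  exact: (measurable_funPTI (eps j) (measurable_set1 1)).
rewrite -(eps_prob1 D_gt0 X_indep X_lattice Veps_indep Veps_law)//.
have <- : (\int[Q]_w (\1_[set w | eps j w = 1] w)%:E)%E = Q [set w | eps j w = 1].
  by rewrite integral_indic// setIT.
apply: ge0_ae_eq_integral => //.
- by apply/measurable_EFinP; exact: measurable_funX.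
- by apply/measurable_EFinP; exact: measurable_indic.
- by move=> w _; rewrite lee_fin sqr_ge0.
have := bernoulli_part_ae D_gt0 X_indep X_lattice Veps_indep Veps_law.
apply: filterS => w [k [e He]] _; rewrite indicE; congr (_%:E).
have [_ ej] := He j; rewrite ej; case: (e j) ej => /= ej.
  by rewrite mem_set// expr1n.
rewrite memNset ?expr0n//= ej => /eqP.
by rewrite eq_sym oner_eq0.
Qed.

Let measurable_S' : measurable_fun setT S'.
Proof.
apply: measurable_funD; first exact: measurable_sum.
by apply: measurable_funM => //; exact: measurable_sum.
Qed.

(** [bernoulli_part_average] for the square: given (V, eps), S - c is S' - c plus
    the sum of the D eps_j (L_j - 1/2), centered and orthogonal, each of square
    D^2 eps_j^2 / 4. *)
Lemma second_moment_transfer c :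
  (\int[P]_w ((S w - c) ^+ 2)%:E =
   \int[Q]_w ((S' w - c) ^+ 2)%:E + (D ^+ 2 * Theta / 4)%:E)%E.
Proof.
rewrite (bernoulli_part_average (F := fun x => (x - c) ^+ 2)); last 2 first.
- by apply: measurable_funX; exact: measurable_funB.
- by move=> x; exact: sqr_ge0.
transitivity (\int[Q]_w (((S' w - c) ^+ 2)%:E +
    (D ^+ 2 / 4)%:E * \sum_(j < n) (eps j w ^+ 2)%:E))%E.
  apply: eq_integral => w _; rewrite sumEFin -EFinM -EFinD; congr (_%:E).
  have := bits_average_sqr (\sum_j V j w - c) (fun j => D * eps j w).
  have -> : \sum_j V j w - c + (\sum_j D * eps j w) / 2 = S' w - c.
    by rewrite -mulr_sumr mulrAC addrAC.
  have -> : (\sum_j (D * eps j w) ^+ 2) / 4 = D ^+ 2 / 4 * \sum_j eps j w ^+ 2.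
    by under eq_bigr do rewrite exprMn; rewrite -mulr_sumr mulrAC.
  move=> <-; apply: eq_bigr => l _; congr (_ * _ ^+ 2).
  rewrite big_split/= addrAC; congr (_ + _).
  by apply: eq_bigr => j _; ring.
have msq j : measurable_fun setT (fun w => (eps j w ^+ 2)%:E).
  by apply/measurable_EFinP; exact: measurable_funX.
have sq0 j w : (0 <= (eps j w ^+ 2)%:E)%E by rewrite lee_fin sqr_ge0.
have D4 : 0 <= D ^+ 2 / 4 by rewrite divr_ge0// sqr_ge0.
have sum0 w : (0 <= \sum_(j < n) (eps j w ^+ 2)%:E)%E by exact: sume_ge0.
rewrite ge0_integralD//; last 4 first.
- by move=> w _; rewrite lee_fin sqr_ge0.
- apply/measurable_EFinP; apply: measurable_funX; exact: measurable_funB.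
- by move=> w _; rewrite mule_ge0.
- by apply: emeasurable_funM => //; exact: emeasurable_sum.
rewrite ge0_integralZl//; last exact: emeasurable_sum.
rewrite ge0_integral_sum//; congr (_ + _)%E.
under eq_bigr do rewrite eps_second_moment.
by rewrite sumEFin -EFinM mulrAC.
Qed.

Lemma sum_Lfun2 : S \in Lfun P 2%:E.
Proof.
have -> : S = \sum_(j < n) (X j : T -> R).
  by apply/funext => w; rewrite fct_sumE.
by rewrite rpred_sum ?lee1n.
Qed.

(** At c = 0 the left side of [second_moment_transfer] is finite, hence so is the
    second moment of S'. *)
Lemma smoothed_Lfun2 : S' \in Lfun Q 2%:E.
Proof.
apply: second_moment_Lfun2 => //.
have := second_moment_transfer 0; rewrite (second_moment_about 0 sum_Lfun2).
under eq_integral do rewrite subr0.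
move=> E; rewrite -ge0_fin_numE; last first.
  by apply: integral_ge0 => w _; rewrite lee_fin sqr_ge0.
by have := @fin_numD R (\int[Q]_w (S' w ^+ 2)%:E)%E (D ^+ 2 * Theta / 4)%:E;
  rewrite -E/= andbT => <-.
Qed.

(** Both sides of [second_moment_transfer] are polynomials in c, so their
    coefficients agree; the values at 0 and 1 suffice. *)
Lemma smoothed_moments :
  esp P S = esp Q S' /\ var P S = var Q S' + D ^+ 2 * Theta / 4.
Proof.
have q c : var P S + (esp P S - c) ^+ 2 =
    var Q S' + (esp Q S' - c) ^+ 2 + D ^+ 2 * Theta / 4.
  apply: EFin_inj; rewrite -(second_moment_about c sum_Lfun2).
  by rewrite second_moment_transfer (second_moment_about c smoothed_Lfun2).
have q0 := q 0; have q1 := q 1.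
have e : esp P S = esp Q S' by nra.
by split => //; move: q0; rewrite e; nra.
Qed.

End bernoulli_part_moments.

(** * Estimates on real numbers *)

Section real_estimates.
Context (R : realType).
Implicit Types D h Theta v u x b N : R.

Lemma powRN32_le b N : 0 < b -> b <= N ->
  N `^ (- (3 / 2)) <= 1 / (Num.sqrt b * b).
Proof.
move=> b0 bN; have N0 := lt_le_trans b0 bN.
have pow32 (y : R) : 0 < y -> y `^ (3 / 2) = Num.sqrt y * y.
  move=> y0; have -> : (3 / 2 : R) = 2^-1 + 1 by field.
  rewrite powRD; last by rewrite (gt_eqF y0) implybT.
  by rewrite powR12_sqrt ?ltW// powRr1 ?ltW.
rewrite powRN pow32// div1r lef_pV2 ?posrE ?mulr_gt0 ?sqrtr_gt0//.
by apply: ler_pM; rewrite ?sqrtr_ge0 ?(ltW b0) ?ler_wsqrtr.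
Qed.

(** The peak of the smoothed bump against that of the normal law of variance v;
    p comes from the lower or upper bound on B in the peak, q from the opposite
    bound in the exponent. *)
Lemma gaussian_peak_ratio D Theta v p q :
  0 < D -> 0 < Theta -> 0 < v -> 0 < p -> 0 < q ->
  Num.sqrt (2 / (pi * (p * Theta))) *
    (D / 2 * Num.sqrt (q * Theta) / Num.sqrt v) =
  Num.sqrt (q / p) * (D / Num.sqrt (2 * pi * v)).
Proof.
move=> D0 T0 v0 p0 q0; have pi0 := pi_gt0 R.
have pv0 : 0 < 2 * pi * v by rewrite !mulr_gt0.
have pT0 : 0 < pi * (p * Theta) by rewrite !mulr_gt0.
have qT0 : 0 < q * Theta by rewrite mulr_gt0.
apply/eqP; rewrite -(@eqrXn2 _ 2) ?mulr_ge0 ?divr_ge0 ?mulr_ge0 ?sqrtr_ge0 ?(ltW D0)//.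
have qp0 : 0 < q / p by rewrite divr_gt0.
have cT0 : 0 < 2 / (pi * (p * Theta)) by rewrite divr_gt0.
rewrite !(exprMn, exprVn) (sqr_sqrtr (ltW cT0)) (sqr_sqrtr (ltW qT0)).
rewrite (sqr_sqrtr (ltW v0)) (sqr_sqrtr (ltW qp0)) (sqr_sqrtr (ltW pv0)).
clear pv0 pT0 cT0.
apply/eqP; move: pi0; move: (pi : R) => c c0.
by field; rewrite !gt_eqF.
Qed.

Lemma sqrt_ge1_le (r : R) : 1 <= r -> Num.sqrt r <= r.
Proof.
move=> r1; have r0 : 0 <= r by apply: le_trans r1.
rewrite -{2}(sqr_sqrtr r0) expr2 ler_peMr ?sqrtr_ge0//.
by rewrite -(@sqrtr1 R) ler_wsqrtr.
Qed.

Lemma le1_sqrt_ge (r : R) : 0 <= r <= 1 -> r <= Num.sqrt r.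
Proof.
move=> /andP[r0 r1].
rewrite -{1}(sqr_sqrtr r0) expr2 ler_piMr ?sqrtr_ge0//.
by rewrite -(@sqrtr1 R) ler_wsqrtr.
Qed.

(** With w = Var S, the variance of the smoothed bump is
    w + h D^2 Theta / 4, which lies between w (used in the peak) and (1 + h) w
    (used in the exponent). *)
Lemma gaussian_peak_le D h Theta v x : 0 < D -> 0 < h -> h < 1 -> 0 < Theta ->
  0 <= v ->
  Num.sqrt (2 / (pi * ((1 - h) * Theta))) *
   (D / 2 * Num.sqrt ((1 + h) * Theta) /
      Num.sqrt ((D / 2 * Num.sqrt ((1 + h) * Theta)) ^+ 2 + v) *
    expR (- (x ^+ 2 /
      (2 * ((D / 2 * Num.sqrt ((1 + h) * Theta)) ^+ 2 + v))))) <=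
  (1 + h) / (1 - h) * (D / Num.sqrt (2 * pi * (v + D ^+ 2 * Theta / 4))) *
    expR (- (x ^+ 2 / (2 * (1 + h) * (v + D ^+ 2 * Theta / 4)))).
Proof.
move=> D0 h0 h1 T0 v0; have pi0 := pi_gt0 R.
have h1' : 0 < 1 + h by rewrite addr_gt0.
have D2T : 0 < D ^+ 2 * Theta by rewrite mulr_gt0// exprn_gt0.
set w := v + _; have w0 : 0 < w by rewrite /w; lra.
have -> : (D / 2 * Num.sqrt ((1 + h) * Theta)) ^+ 2 + v = w + h * (D ^+ 2 * Theta) / 4.
  by rewrite exprMn sqr_sqrtr ?mulr_ge0 ?ltW ?addr_gt0// /w; field.
have hDT : 0 < h * (D ^+ 2 * Theta) by rewrite mulr_gt0.
set u := w + _; have wu : w <= u by rewrite /u; lra.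
have uw : u <= (1 + h) * w.
  have := mulr_ge0 (ltW h0) v0; rewrite /u /w; lra.
have u0 : 0 < u by exact: lt_le_trans wu.
rewrite [leLHS]mulrA gaussian_peak_ratio ?subr_gt0//.
apply: ler_pM; rewrite ?mulr_ge0 ?divr_ge0 ?sqrtr_ge0 ?expR_ge0 ?(ltW D0)//.
- apply: ler_pM; rewrite ?divr_ge0 ?sqrtr_ge0 ?(ltW D0)//.
    by apply: sqrt_ge1_le; rewrite ler_pdivlMr ?subr_gt0//; lra.
  rewrite ler_pM2l// lef_pV2 ?posrE ?sqrtr_gt0 ?mulr_gt0//.
  by rewrite ler_wsqrtr// ler_pM2l// mulr_gt0.
- rewrite ler_expR lerN2 -mulrA; apply: ler_wpM2l; first exact: sqr_ge0.
  by rewrite lef_pV2 ?posrE ?mulr_gt0// ler_pM2l.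
Qed.

(** Here the variance of the smoothed bump lies between (1 - h) w and w. *)
Lemma gaussian_peak_ge D h Theta v x : 0 < D -> 0 < h -> h < 1 -> 0 < Theta ->
  0 <= v ->
  (1 - h) / (1 + h) * (D / Num.sqrt (2 * pi * (v + D ^+ 2 * Theta / 4))) *
    expR (- (x ^+ 2 / (2 * (1 - h) * (v + D ^+ 2 * Theta / 4)))) <=
  Num.sqrt (2 / (pi * ((1 + h) * Theta))) *
   (D / 2 * Num.sqrt ((1 - h) * Theta) /
      Num.sqrt ((D / 2 * Num.sqrt ((1 - h) * Theta)) ^+ 2 + v) *
    expR (- (x ^+ 2 /
      (2 * ((D / 2 * Num.sqrt ((1 - h) * Theta)) ^+ 2 + v))))).
Proof.
move=> D0 h0 h1 T0 v0; have pi0 := pi_gt0 R.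
have h1' : 0 < 1 - h by rewrite subr_gt0.
have h2 : 0 < 1 + h by rewrite addr_gt0.
have D2T : 0 < D ^+ 2 * Theta by rewrite mulr_gt0// exprn_gt0.
set w := v + _; have w0 : 0 < w by rewrite /w; lra.
have -> : (D / 2 * Num.sqrt ((1 - h) * Theta)) ^+ 2 + v = w - h * (D ^+ 2 * Theta) / 4.
  by rewrite exprMn sqr_sqrtr ?mulr_ge0 ?ltW// /w; field.
have hDT : 0 < h * (D ^+ 2 * Theta) by rewrite mulr_gt0.
set u := w - _; have uw : u <= w by rewrite /u; lra.
have wu : (1 - h) * w <= u.
  have := mulr_ge0 (ltW h0) v0; rewrite /u /w; lra.
have u0 : 0 < u by apply: lt_le_trans wu; rewrite mulr_gt0.
rewrite [leRHS]mulrA gaussian_peak_ratio//.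
apply: ler_pM; rewrite ?mulr_ge0 ?divr_ge0 ?sqrtr_ge0 ?expR_ge0 ?(ltW h1') ?(ltW D0) ?invr_ge0 ?(ltW h2)//.
- apply: ler_pM; rewrite ?divr_ge0 ?sqrtr_ge0 ?(ltW h1') ?(ltW D0) ?invr_ge0 ?(ltW h2)//.
    apply: le1_sqrt_ge; rewrite divr_ge0 ?(ltW h1') ?(ltW h2)//=.
    by rewrite ler_pdivrMr ?addr_gt0//; lra.
  rewrite ler_pM2l// lef_pV2 ?posrE ?sqrtr_gt0 ?mulr_gt0//.
  by rewrite ler_wsqrtr// ler_pM2l// mulr_gt0.
- rewrite ler_expR lerN2 -[_ * (1 - h) * w]mulrA; apply: ler_wpM2l; first exact: sqr_ge0.
  by rewrite lef_pV2 ?posrE ?mulr_gt0// ler_pM2l.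
Qed.

End real_estimates.

(** * The conditional law of the sum *)

Section local_limit.
Context (R : realType).
Context d0 (T0 : measurableType d0) (P0 : probability T0 R).
Variables (b : nat -> {RV P0 >-> R}) (C0 : R).
Hypothesis C0P : local_limit_constant b C0.

Lemma local_limit_constant_ge0 : 0 <= C0.
Proof.
have := C0P (ltn0Sn 0) 0; rewrite powR1 mulr1.
exact: le_trans.
Qed.

(** With c = (1 +- h) Theta, the exponent x^2 / (2 a^2) for a = D sqrt c / 2 is
    the exponent (2 z - N)^2 / (2 c) of the local limit theorem with c for N.
    The peak and the exponential are bounded separately, from opposite ends of
    the window for N. *)
Lemma local_limit_window (D h Theta : R) (N : nat) (z : int) :
  0 < D -> 0 < h -> h < 1 -> 0 < Theta -> `|N%:R - Theta| <= h * Theta ->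
  let x := D / 2 * (2 * z%:~R - N%:R) in
  let g := fine (P0 [set w | \sum_(i < N) b i w = z%:~R]) in
  let err := C0 * (1 / (Num.sqrt ((1 - h) * Theta) * ((1 - h) * Theta))) in
  g <= Num.sqrt (2 / (pi * ((1 - h) * Theta))) *
      expR (- (x ^+ 2 / (2 * (D / 2 * Num.sqrt ((1 + h) * Theta)) ^+ 2))) + err
  /\
  Num.sqrt (2 / (pi * ((1 + h) * Theta))) *
      expR (- (x ^+ 2 / (2 * (D / 2 * Num.sqrt ((1 - h) * Theta)) ^+ 2))) - err
  <= g.
Proof.
move=> D0 h0 h1 T0' NT x g err; have pi0 := pi_gt0 R.
have hm : 0 < 1 - h by rewrite subr_gt0.
have hp : 0 < 1 + h by rewrite addr_gt0.
have mT : 0 < (1 - h) * Theta by rewrite mulr_gt0.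
have pT : 0 < (1 + h) * Theta by rewrite mulr_gt0.
have [Nlo Nhi] : (1 - h) * Theta <= N%:R /\ N%:R <= (1 + h) * Theta.
  by move: NT; rewrite ler_norml => /andP[? ?]; split; lra.
have N0 : 0 < N%:R :> R by exact: lt_le_trans Nlo.
have N0' : (0 < N)%N by move: N0; rewrite ltr0n.
have errN : C0 * N%:R `^ (- (3 / 2)) <= err.
  by apply: ler_wpM2l; [exact: local_limit_constant_ge0|exact: powRN32_le].
have := le_trans (C0P N0' z) errN; rewrite -/g ler_norml => /andP[lo hi].
have expoE c : 0 < c -> x ^+ 2 / (2 * (D / 2 * Num.sqrt c) ^+ 2) =
    (2 * z%:~R - N%:R) ^+ 2 / (2 * c).
  move=> c0; rewrite [(D / 2 * Num.sqrt c) ^+ 2]exprMn (sqr_sqrtr (ltW c0)) /x.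
  by field; rewrite !gt_eqF.
rewrite !expoE//; set y := (2 * z%:~R - N%:R) ^+ 2 in lo hi *.
have y0 : 0 <= y by exact: sqr_ge0.
have sqrt_le u v : 0 < u -> u <= v ->
    Num.sqrt (2 / (pi * v)) <= Num.sqrt (2 / (pi * u)).
  move=> u0 uv; have v0 := lt_le_trans u0 uv.
  apply: ler_wsqrtr; apply: ler_wpM2l => //.
  by rewrite lef_pV2 ?posrE ?mulr_gt0 ?pi_gt0// ler_pM2l ?pi_gt0.
have exp_le u v : 0 < u -> u <= v ->
    expR (- (y / (2 * u))) <= expR (- (y / (2 * v))).
  move=> u0 uv; have v0 := lt_le_trans u0 uv.
  rewrite ler_expR lerN2; apply: ler_wpM2l => //.
  by rewrite lef_pV2 ?posrE ?mulr_gt0// ler_pM2l.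
split.
- have up : Num.sqrt (2 / (pi * N%:R)) * expR (- (y / (2 * N%:R))) <=
      Num.sqrt (2 / (pi * ((1 - h) * Theta))) * expR (- (y / (2 * ((1 + h) * Theta)))).
    by apply: ler_pM; rewrite ?sqrtr_ge0 ?expR_ge0 ?sqrt_le ?exp_le.
  lra.
- have dn : Num.sqrt (2 / (pi * ((1 + h) * Theta))) * expR (- (y / (2 * ((1 - h) * Theta))))
      <= Num.sqrt (2 / (pi * N%:R)) * expR (- (y / (2 * N%:R))).
    by apply: ler_pM; rewrite ?sqrtr_ge0 ?expR_ge0 ?sqrt_le ?exp_le.
  lra.
Qed.

End local_limit.

Section conditional_law.
Context (R : realType) (v0 D : R) (n : nat).
Context d0 (T0 : measurableType d0) (P0 : probability T0 R).
Variables (b : nat -> {RV P0 >-> R}).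
Hypothesis fair_b : fair_bits b.
Context d (T : measurableType d) (P : probability T R) (X : 'I_n -> {RV P >-> R}).
Context d' (T' : measurableType d') (Q : probability T' R).
Variables (V eps : 'I_n -> {RV Q >-> R}) (th : 'I_n -> R).
Hypothesis D_gt0 : 0 < D.
Hypothesis X_indep : mutually_independent P (fun j w => X j w).
Hypothesis X_lattice : forall j, P (X j @^-1` lattice v0 D) = 1%E.
Hypothesis Veps_indep : mutually_independent Q (fun j w => (V j w, eps j w)).
Hypothesis Veps_law :
  forall j, has_bernoulli_part_law v0 D (th j) (X j) (V j) (eps j).
Variable kappa : R.
Hypothesis kappa_lattice : lattice (v0 * n%:R) D kappa.

(** The conditional probability of S = kappa given (V, eps), as an average over
    the values of the n fair bits. *)
Definition conditional_mass (w : T') : R :=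
  \sum_(l : {ffun 'I_n -> bool})
    (2^-1) ^+ n * \1_[set kappa] (\sum_j (V j w + D * (l j)%:R * eps j w)).

Lemma integral_conditional_mass :
  (P [set w | (\sum_(j < n) X j w)%R = kappa] =
   \int[Q]_w (conditional_mass w)%:E)%E.
Proof.
have mk : measurable [set w | \sum_(j < n) X j w = kappa].
  have -> : [set w | \sum_(j < n) X j w = kappa] =
      (fun w => \sum_(j < n) X j w) @^-1` [set kappa] by [].
  rewrite -[X in measurable X]setTI; exact: measurable_sum.
rewrite -(bernoulli_part_average D_gt0 X_indep X_lattice Veps_indep Veps_law
  (F := \1_[set kappa]))//.
have -> : (\int[P]_w (\1_[set kappa] (\sum_(j < n) X j w))%:E =
    \int[P]_w (\1_[set w | \sum_(j < n) X j w = kappa] w)%:E)%E by [].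
by rewrite integral_indic// setIT.
Qed.

Lemma measurable_conditional_mass : measurable_fun setT conditional_mass.
Proof.
apply: measurable_sum => l; apply: measurable_funM => //.
apply: (@measurableT_comp _ _ _ _ _ _ (\1_[set kappa] : R -> R)).
  exact: measurable_indic.
apply: measurable_sum => j.
by apply: measurable_funD => //; apply: measurable_funM.
Qed.

Lemma conditional_mass01 w : 0 <= conditional_mass w <= 1.
Proof.
have a0 : 0 <= (2^-1 : R) ^+ n by rewrite exprn_ge0 ?invr_ge0.
apply/andP; split.
  by apply: sumr_ge0 => l _; rewrite mulr_ge0// indicE ler0n.
rewrite -(half_pow_bits_card R n) mulr_natr -sumr_const.
apply: ler_sum => l _; rewrite ler_piMr// indicE.
Qed.

(** On the almost sure event where V_j is a lattice point and eps_j is a bit, the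
    equation W + D (sum of the eps_j l_j) = kappa prescribes the integer
    z = (kappa - W) / D as the value of a masked sum of bits. *)
Lemma conditional_mass_ae : {ae Q, forall w, exists (N : nat) (z : int),
  [/\ \sum_(j < n) eps j w = N%:R,
      kappa - (\sum_(j < n) V j w + D / 2 * \sum_(j < n) eps j w) =
        D / 2 * (2 * z%:~R - N%:R) &
      conditional_mass w =
        fine (P0 [set w0 | \sum_(i < N) b i w0 = z%:~R])]}.
Proof.
have [k0 _ k0E] := kappa_lattice.
apply: filterS (bernoulli_part_ae D_gt0 X_indep X_lattice Veps_indep Veps_law).
move=> w [k [e He]]; exists (\sum_j e j)%N, (k0 - \sum_j k j).
have epsE : \sum_(j < n) eps j w = (\sum_j e j)%N%:R.
  by rewrite natr_sum; apply: eq_bigr => j _; have [] := He j.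
have VE : \sum_(j < n) V j w = v0 * n%:R + D * (\sum_j k j)%:~R.
  rewrite (eq_bigr (fun j => v0 + D * (k j)%:~R)); last first.
    by move=> j _; have [] := He j.
  by rewrite big_split/= sumr_const card_ord mulr_natr -mulr_sumr rmorph_sum.
split => //.
  by rewrite VE epsE -k0E /lattice_point intrB; field.
rewrite (fair_bits_pmf fair_b) -masked_bits_sum; apply: eq_bigr => l _.
congr (_ * _); rewrite indicE; congr (nat_of_bool _)%:R.
have -> : \sum_j (V j w + D * (l j)%:R * eps j w) =
    v0 * n%:R + D * (\sum_j k j + (\sum_j e j * l j)%N%:Z)%:~R.
  rewrite big_split/= VE intrD mulrDr addrA; congr (_ + _).
  rewrite -pmulrn natr_sum mulr_sumr; apply: eq_bigr => j _.
  by have [_ ->] := He j; rewrite natrM -mulrA [(l j)%:R * _]mulrC.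
apply/idP/eqP => [/set_mem/=|zE].
  rewrite -k0E => /(lattice_point_inj D_gt0) <-.
  by rewrite addrC addKr.
by apply/mem_set; rewrite /= -k0E /lattice_point zE [_ + (k0 - _)]addrC subrK.
Qed.

End conditional_law.

(** * The two bounds *)

Section bounded_integrals.
Context d (T : measurableType d) (R : realType) (P : probability T R).

Lemma integral_affine (f : T -> R) (A : set T) (c e r : R) :
  measurable_fun setT f -> (forall w, 0 <= f w <= 1) -> measurable A ->
  0 <= c -> 0 <= e -> 0 <= r ->
  (\int[P]_w (c * f w + e + r * \1_A w)%:E =
   (c * fine (\int[P]_w (f w)%:E) + e + r * fine (P A))%:E)%E.
Proof.
move=> mf f01 mA c0 e0 r0.
have f0 w : 0 <= f w by case/andP: (f01 w).
under eq_integral do rewrite !EFinD !EFinM.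
have mcf : measurable_fun setT (fun w => (c%:E * (f w)%:E)%E).
  by apply/measurable_EFinP; exact: measurable_funM.
have mrA : measurable_fun setT (fun w => (r%:E * (\1_A w)%:E)%E).
  by apply/measurable_EFinP; apply: measurable_funM => //; exact: measurable_indic.
rewrite ge0_integralD//; last 3 first.
- by move=> w _; rewrite -EFinM -EFinD lee_fin addr_ge0// mulr_ge0.
- exact: emeasurable_funD.
- by move=> w _; rewrite -EFinM lee_fin mulr_ge0.
rewrite ge0_integralD//; last by move=> w _; rewrite -EFinM lee_fin mulr_ge0.
rewrite ge0_integralZl//; last first.
- by move=> w _; rewrite lee_fin.
- exact/measurable_EFinP.
rewrite ge0_integralZl//; last first.
  by apply/measurable_EFinP; exact: measurable_indic.
rewrite integral_indic// setIT integral_cst//= probability_setT mule1.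
rewrite -(fineK (bounded_integral_fin_num P mf f01)).
by rewrite -(fineK (fin_num_measure P _ mA)).
Qed.

(** The shape of the two pointwise bounds: f and g are a Gaussian bump and the
    conditional mass, in either order, and A is the event that B is far from
    Theta. *)
Lemma affine_integral_le (f g : T -> R) (A : set T) (c c' e r : R) :
  measurable_fun setT f -> measurable_fun setT g ->
  (forall w, 0 <= f w <= 1) -> (forall w, 0 <= g w <= 1) -> measurable A ->
  0 <= c -> 0 <= c' -> 0 <= e -> 0 <= r ->
  {ae P, forall w, c' * g w <= c * f w + e + r * \1_A w} ->
  c' * fine (\int[P]_w (g w)%:E) <=
  c * fine (\int[P]_w (f w)%:E) + e + r * fine (P A).
Proof.
move=> mf mg f01 g01 mA c0 c'0 e0 r0 H.
have f0 w : 0 <= f w by case/andP: (f01 w).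
have g0 w : 0 <= g w by case/andP: (g01 w).
rewrite -lee_fin -integral_affine//.
have -> : (c' * fine (\int[P]_w (g w)%:E))%:E =
    (\int[P]_w (c' * g w + 0 + 0 * \1_A w)%:E)%E.
  by rewrite integral_affine// addr0 mul0r addr0.
apply: ae_ge0_le_integral => //.
- by move=> w _; rewrite lee_fin mul0r !addr0 mulr_ge0.
- apply/measurable_EFinP; apply: measurable_funD.
    by apply: measurable_funD => //; exact: measurable_funM.
  by apply: measurable_funM => //; exact: measurable_indic.
- by move=> w _; rewrite lee_fin !addr_ge0 ?mulr_ge0 ?indicE.
- apply/measurable_EFinP; apply: measurable_funD.
    by apply: measurable_funD => //; exact: measurable_funM.
  by apply: measurable_funM => //; exact: measurable_indic.
by apply: filterS H => w Hw _; rewrite lee_fin mul0r !addr0.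
Qed.

End bounded_integrals.

Section error_terms.
Context (R : realType).

Lemma sqrt_2_pi_le (b c : R) : 0 < b -> b <= c ->
  Num.sqrt (2 / (pi * c)) <= (Num.sqrt b)^-1.
Proof.
move=> b0 bc; have c0 := lt_le_trans b0 bc; have pi0 := pi_gt0 R.
rewrite -sqrtrV; last exact: ltW.
apply: ler_wsqrtr; rewrite ler_pdivrMr ?mulr_gt0// mulrCA.
rewrite -[2]mulr1; apply: ler_pM => //; first exact: pi_ge2.
by rewrite mulrC ler_pdivlMr// mul1r.
Qed.

(** The factor 2 of the bump comparison is absorbed by the 4 in the maximum, and
    C0 by the maximum itself.  The upper bound uses this with rho = 0. *)
Lemma error_terms_le (b C0 c H rho : R) : 0 < b -> 0 <= C0 -> 0 <= H ->
  0 <= rho -> c <= (Num.sqrt b)^-1 ->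
  c * (2 * H + rho) + C0 * (1 / (Num.sqrt b * b)) <=
  Num.max 4 C0 / Num.sqrt b * (H + 1 / b + 2 * rho).
Proof.
move=> b0 C00 H0 rho0 cb; set t := (Num.sqrt b)^-1 in cb *.
have t0 : 0 <= t by rewrite invr_ge0 sqrtr_ge0.
set M := Num.max 4 C0.
have M4 : 4 <= M by rewrite le_max lexx.
have MC : C0 <= M by rewrite le_max lexx orbT.
have bi : 0 <= b^-1 by rewrite invr_ge0 ltW.
have -> : C0 * (1 / (Num.sqrt b * b)) = t * (C0 * b^-1).
  by rewrite div1r invfM mulrCA.
rewrite div1r [M * t]mulrC -mulrA.
apply: (@le_trans _ _ (t * (2 * H + rho) + t * (C0 * b^-1))).
  by rewrite lerD2r; apply: ler_wpM2r => //; rewrite addr_ge0// mulr_ge0.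
rewrite -mulrDr; apply: ler_wpM2l => //.
have h1 := ler_wpM2r H0 M4; have h2 := ler_wpM2r rho0 M4; have h3 := ler_wpM2r bi MC.
rewrite !mulrDr; lra.
Qed.

Lemma lower_bound_combine (M G E U err c H rho p : R) : M <= c * G ->
  c * (2 * H + rho) + err <= U -> c * E <= p + err + c * rho ->
  - (2 * H) <= E - G -> 0 <= c -> 0 <= rho -> M - U - rho <= p.
Proof.
move=> MG cU cE EG c0 rho0; have := ler_wpM2l c0 EG.
by rewrite mulrBr mulrN; move: cU; rewrite mulrDr; lra.
Qed.

End error_terms.
Theorem theorem1p7 (R : realType) (v0 D : R) (D_gt0 : 0 < D)
  (d0 : measure_display) (T0 : measurableType d0) (P0 : probability T0 R)
  (b : nat -> {RV P0 >-> R}) (fair_b : fair_bits b)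
  (C0 : R) (C0P : local_limit_constant b C0)
  (n : nat) (n_gt0 : (0 < n)%N)
  (d : measure_display) (T : measurableType d) (P : probability T R)
  (X : 'I_n -> {RV P >-> R})
  (X_indep : mutually_independent P (fun j w => X j w))
  (X_L2 : forall j, (X j : T -> R) \in Lfun P 2%:E)
  (X_lattice : forall j, P (X j @^-1` lattice v0 D) = 1%E)
  (X_vartheta : forall j, 0 < vartheta v0 D (X j))
  (h : R) (h_gt0 : 0 < h) (h_lt1 : h < 1)
  (th : 'I_n -> R) (th_gt0 : forall j, 0 < th j)
  (th_le : forall j, th j <= vartheta v0 D (X j))
  (d' : measure_display) (T' : measurableType d') (P' : probability T' R)
  (V eps : 'I_n -> {RV P' >-> R})
  (Veps_indep : mutually_independent P' (fun j w => (V j w, eps j w)))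
  (Veps_law : forall j, has_bernoulli_part_law v0 D (th j) (X j) (V j) (eps j))
  (kappa : R) (kappa_lattice : lattice (v0 * n%:R) D kappa) :
  let S := fun w => \sum_(j < n) X j w in
  let W := fun w => \sum_(j < n) V j w in
  let B := fun w => \sum_(j < n) eps j w in
  let S' := fun w => W w + D / 2 * B w in
  let Theta := \sum_(j < n) th j in
  let H := normal_distance P' S' in
  let rho := fine (P' [set w | `|B w - Theta| > h * Theta]) in
  let C1 := Num.max 4 C0 in
  let p := fine (P [set w | S w = kappa]) in
  p <= (1 + h) / (1 - h) * (D / Num.sqrt (2 * pi * var P S))
         * expR (- ((kappa - esp P S) ^+ 2 / (2 * (1 + h) * var P S)))
       + C1 / Num.sqrt ((1 - h) * Theta) * (H + 1 / ((1 - h) * Theta))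
       + rho
  /\
  p >= (1 - h) / (1 + h) * (D / Num.sqrt (2 * pi * var P S))
         * expR (- ((kappa - esp P S) ^+ 2 / (2 * (1 - h) * var P S)))
       - C1 / Num.sqrt ((1 - h) * Theta)
         * (H + 1 / ((1 - h) * Theta) + 2 * rho)
       - rho.
Proof.
move=> S W B S' Theta H rho C1 p.
have Theta_gt0 : 0 < Theta.
  rewrite /Theta (bigD1 (Ordinal n_gt0))//= ltr_wpDr// sumr_ge0// => j _.
  exact: ltW.
have hm : 0 < 1 - h by rewrite subr_gt0.
have hp : 0 < 1 + h by rewrite addr_gt0.
have mT : 0 < (1 - h) * Theta by rewrite mulr_gt0.
have pT : 0 < (1 + h) * Theta by rewrite mulr_gt0.
have C0_ge0 := local_limit_constant_ge0 C0P.
have [espE varE] := smoothed_moments D_gt0 X_indep X_lattice Veps_indep Veps_law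
  X_L2 X_vartheta th_gt0.
have S'_L2 := smoothed_Lfun2 D_gt0 X_indep X_lattice Veps_indep Veps_law
  X_L2 X_vartheta th_gt0.
rewrite -/S -/S' -/Theta in espE varE S'_L2.
have mB : measurable_fun setT B by exact: measurable_sum.
have mS' : measurable_fun setT S'.
  apply: measurable_funD; first exact: measurable_sum.
  exact: measurable_funM.
pose A := [set w | `|B w - Theta| > h * Theta].
have mA : measurable A.
  have -> : A = (fun w => `|B w - Theta|) @^-1` `]h * Theta, +oo[.
    by apply/seteqP; split=> w /=; rewrite in_itv/= andbT.
  rewrite -[X in measurable X]setTI.
  have mf : measurable_fun setT (fun w => `|B w - Theta|).
    by apply: measurableT_comp => //; exact: measurable_funB.
  exact: mf.
have rho_ge0 : 0 <= rho by rewrite fine_ge0.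
have H_ge0 : 0 <= H by exact: normal_distance_ge0.
pose phi a w := expR (- ((kappa - S' w) ^+ 2 / (2 * a ^+ 2))).
have mphi a : measurable_fun setT (phi a).
  apply: measurableT_comp => //; apply: measurableT_comp => //.
  apply: measurable_funM => //; apply: measurable_funX; exact: measurable_funB.
have phi01 a w : 0 <= phi a w <= 1.
  rewrite expR_ge0/= -expR0 ler_expR oppr_le0 divr_ge0 ?sqr_ge0//.
  by rewrite mulr_ge0// sqr_ge0.
pose g := conditional_mass D V eps kappa.
have mg : measurable_fun setT g by exact: measurable_conditional_mass.
have g01 w : 0 <= g w <= 1 by exact: conditional_mass01.
have pE : p = fine (\int[P']_w (g w)%:E)%E.
  by rewrite /p (integral_conditional_mass D_gt0 X_indep X_lattice Veps_indep Veps_law).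
pose err := C0 * (1 / (Num.sqrt ((1 - h) * Theta) * ((1 - h) * Theta))).
have err_ge0 : 0 <= err by rewrite mulr_ge0// divr_ge0// mulr_ge0 ?sqrtr_ge0 ?ltW.
pose ap := D / 2 * Num.sqrt ((1 + h) * Theta).
pose am := D / 2 * Num.sqrt ((1 - h) * Theta).
have ap_gt0 : 0 < ap by rewrite mulr_gt0 ?divr_gt0 ?sqrtr_gt0.
have am_gt0 : 0 < am by rewrite mulr_gt0 ?divr_gt0 ?sqrtr_gt0.
pose c1 := Num.sqrt (2 / (pi * ((1 - h) * Theta))).
pose c2 := Num.sqrt (2 / (pi * ((1 + h) * Theta))).
have c1_ge0 : 0 <= c1 by exact: sqrtr_ge0.
have c2_ge0 : 0 <= c2 by exact: sqrtr_ge0.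
have window : {ae P', forall w, ~ A w ->
    g w <= c1 * phi ap w + err /\ c2 * phi am w - err <= g w}.
  apply: filterS (conditional_mass_ae fair_b D_gt0 X_indep X_lattice Veps_indep
    Veps_law kappa_lattice) => w [N [z [BN xE gE]]] /negP.
  rewrite -leNgt /B BN => NT.
  have := local_limit_window C0P z D_gt0 h_gt0 h_lt1 Theta_gt0 NT.
  by rewrite /= -xE -gE.
(* On A, where B is far from Theta, g is only bounded by 1: this costs rho. *)
have upper : p <= c1 * fine (\int[P']_w (phi ap w)%:E)%E + err + rho.
  rewrite pE -[leLHS]mul1r -[rho]mul1r.
  apply: affine_integral_le => //.
  apply: filterS window => w Hw; rewrite mul1r mul1r indicE.
  have [wA|/negP wA] := boolP (w \in A).
    have /andP[_ g1] := g01 w; have /andP[phi0 _] := phi01 ap w.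
    by rewrite (le_trans g1)// lerDr addr_ge0// mulr_ge0.
  have [|gw _] := Hw; first by move=> Aw; apply: wA; rewrite inE.
  by rewrite addr0.
(* On A the bump is only bounded by 1: this costs c2 rho. *)
have lower : c2 * fine (\int[P']_w (phi am w)%:E)%E <= p + err + c2 * rho.
  rewrite pE -[X in X + err]mul1r.
  apply: affine_integral_le => //.
  apply: filterS window => w Hw; rewrite mul1r indicE.
  have [wA|/negP wA] := boolP (w \in A).
    have /andP[g0 _] := g01 w; have /andP[_ phi1] := phi01 am w.
    by rewrite mulr1 (le_trans (ler_piMr c2_ge0 phi1))// lerDr addr_ge0.
  have [|_ gw] := Hw; first by move=> Aw; apply: wA; rewrite inE.
  by rewrite mulr0 addr0 -lerBlDr.
have := integral_bump_normal_distance S'_L2 kappa ap_gt0.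
have := integral_bump_normal_distance S'_L2 kappa am_gt0.
rewrite -/H -!/(phi _ _) !ler_norml => /andP[gauss_lo _] /andP[_ gauss_up].
have var0 := var_ge0 P' S'.
have main_up := gaussian_peak_le (kappa - esp P S) D_gt0 h_gt0 h_lt1 Theta_gt0 var0.
have main_lo := gaussian_peak_ge (kappa - esp P S) D_gt0 h_gt0 h_lt1 Theta_gt0 var0.
have mpT : (1 - h) * Theta <= (1 + h) * Theta.
  by rewrite ler_pM2r// lerD2l ge0_cp ?ltW.
have err_up := error_terms_le mT C0_ge0 H_ge0 (lexx 0) (sqrt_2_pi_le mT (lexx _)).
have err_lo := error_terms_le mT C0_ge0 H_ge0 rho_ge0 (sqrt_2_pi_le mT mpT).
rewrite -/c1 -/c2 -/ap -/am -/err -/C1 -varE in main_up main_lo err_up err_lo.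
rewrite -espE in gauss_up gauss_lo.
rewrite mulr0 !addr0 in err_up.
split.
- apply: (le_trans upper); rewrite lerD2r.
  apply: (le_trans _ (lerD main_up err_up)).
  rewrite addrA lerD2r -mulrDr; apply: ler_wpM2l => //.
  by rewrite -lerBlDl.
- exact: (lower_bound_combine main_lo err_lo lower gauss_lo).
Qed.
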